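(* Let $d\ge 1$, $\beta\in(0,1)$, and let $A(x)=(a_{ij}(x))_{i,j=1}^d$ be measurable and symmetric, satisfying for some $\mu\ge1$ the uniform ellipticity condition $\mu^{-1}|\xi|^2\le a_{ij}(x)\xi_i\xi_j\le \mu|\xi|^2$ for all $x,\xi\in\mathbb R^d$. Let $G(s,x,y)$ be the fundamental solution of $\partial_s u=\nabla\cdot(A(x)\nabla u)$ and let $G^{(\beta)}(t,x,y)=\frac1\beta\int_0^\infty G(t^\beta z,x,y)\,z^{-1-1/\beta}w_\beta(z^{-1/\beta})\,dz$ be the Green's function of $D^\beta_0u=\nabla\cdot(A\nabla u)$, $u(0,\cdot)=Y$. Put $\Omega:=|x-y|^2t^{-\beta}$. Then there exist constants $0<c_1\le C_1$ and $c_2,C_2>0$ such that for all $(t,x,y)\in(0,\infty)\times\mathbb R^d\times\mathbb R^d$: (i) if $\Omega\le1$, then $c_1F(t,\Omega)\le G^{(\beta)}(t,x,y)\le C_1F(t,\Omega)$, where $F(t,\Omega)=t^{-\beta/2}$ if $d=1$, $F(t,\Omega)=t^{-\beta}(|\log\Omega|+1)$ if $d=2$, and $F(t,\Omega)=t^{-d\beta/2}\Omega^{1-d/2}$ if $d\ge3$; (ii) if $\Omega\ge1$, then $$c_1t^{-\frac{d\beta}2}\Omega^{-\frac d2\frac{1-\beta}{2-\beta}}\exp\{-C_2\Omega^{\frac1{2-\beta}}\}\le G^{(\beta)}(t,x,y)\le C_1t^{-\frac{d\beta}2}\Omega^{-\frac d2\frac{1-\beta}{2-\beta}}\exp\{-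c_2\Omega^{\frac1{2-\beta}}\}.$$
   Context: For $\beta\in(0,1)$, $w_\beta$ denotes the probability density on $(0,\infty)$ of the totally positively skewed normalised $\beta$-stable law, i.e. $\int_0^\infty e^{-\lambda x}w_\beta(x)\,dx=e^{-\lambda^\beta}$ for $\lambda\ge0$. $D^\beta_0$ is the Caputo fractional derivative of order $\beta$ in the time variable with base point $0$. Known fact (Aronson): under the stated assumptions (with continuous coefficients) $G$ satisfies $c\,s^{-d/2}e^{-c'|x-y|^2/s}\le G(s,x,y)\le C s^{-d/2}e^{-C'|x-y|^2/s}$ for all $s>0$, $x,y\in\mathbb R^d$. *)

(* Defs.v *)
From HB Require Import structures.
From mathcomp Require Import all_boot all_order all_algebra.
From mathcomp Require Import all_classical all_reals all_analysis.
Set Implicit Arguments. Unset Strict Implicit. Unset Printing Implicit Defensive.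
Import Order.TTheory GRing.Theory Num.Theory.
Local Open Scope classical_set_scope.
Local Open Scope ring_scope.

Definition sqdist (R : realType) (d : nat) (x y : 'rV[R]_d) : R :=
  \sum_(i < d) (x ord0 i - y ord0 i) ^+ 2.

Definition Omega (R : realType) (d : nat) (beta t : R) (x y : 'rV[R]_d) : R :=
  sqdist x y * t `^ (- beta).

(* w is the density of the totally positively skewed normalised beta-stable law:
   a nonnegative measurable density on (0,oo) with Laplace transform exp(-lambda^beta). *)
Definition is_stable_density (R : realType) (beta : R) (w : R -> R) : Prop :=
  (forall x : R, 0 < x -> 0 <= w x) /\
  measurable_fun (`]0%R, +oo[%classic : set R) w /\
  (forall lam : R, 0 <= lam ->
     (\int[@lebesgue_measure R]_(x in (`]0%R, +oo[%classic : set R)) (expR (- (lam * x)) * w x)%:E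
      = (expR (- (lam `^ beta)))%:E)%E).

Definition aronson_bounds (R : realType) (d : nat) (G : R -> 'rV[R]_d -> 'rV[R]_d -> R)
  (c c' C C' : R) : Prop :=
  forall (s : R) (x y : 'rV[R]_d), 0 < s ->
    c * s `^ (- (d%:R / 2)) * expR (- (c' * sqdist x y / s)) <= G s x y /\
    G s x y <= C * s `^ (- (d%:R / 2)) * expR (- (C' * sqdist x y / s)).

Definition Gbeta (R : realType) (d : nat) (beta : R) (w : R -> R)
  (G : R -> 'rV[R]_d -> 'rV[R]_d -> R) (t : R) (x y : 'rV[R]_d) : \bar R :=
  ((beta^-1)%:E *
   \int[@lebesgue_measure R]_(z in (`]0%R, +oo[%classic : set R))
      (G (t `^ beta * z) x y * z `^ (-1 - beta^-1) * w (z `^ (- beta^-1)))%:E)%E.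

(* The function F(t,Omega) of part (i), as an extended real: for d >= 2 and
   Omega = 0 (i.e. x = y) it equals +oo (|log 0| = +oo, 0^{1-d/2} = +oo for d >= 3). *)
Definition Fsmall (R : realType) (d : nat) (beta t Om : R) : \bar R :=
  if d == 1%N then (t `^ (- (beta / 2)))%:E
  else if Om == 0 then +oo%E
  else if d == 2%N then (t `^ (- beta) * (`|ln Om| + 1))%:E
  else (t `^ (- (d%:R * beta / 2)) * Om `^ (1 - d%:R / 2))%:E.

(* Main.v *)
Require Import Defs.
From HB Require Import structures.
From mathcomp Require Import all_boot all_order all_algebra.
From mathcomp Require Import all_classical all_reals all_analysis.
From mathcomp Require Import measurable_realfun ring lra.
Set Implicit Arguments.
Unset Strict Implicit.
Unset Printing Implicit Defensive.
Import Order.TTheory GRing.Theory Num.Theory.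
Local Open Scope classical_set_scope.
Local Open Scope ring_scope.

(** Substituting z = u^(-beta) turns G^(beta) into the expectation of
    G((t/S)^beta, x, y), where S has density w.  With X = S^beta and p = d/2,
    Aronson's bounds sandwich it between constant multiples of
    t^(-p beta) E[X^p exp(-K Omega X)], so only integrals against w matter and no
    pointwise information on w is needed.  Everything is extracted from the Laplace
    transform, E[exp(-(X/y)^(1/beta))] = exp(-1/y), through pointwise inequalities
    between such exponentials and indicators: they give P(X > y) of order 1/y, a
    lower bound of order 1/y for P(y < X <= M y), and lower and upper bounds of the
    form exp(- const * L) for the mass of X near 0 at scale y0, where
    L = Omega^(1/(2-beta)) and Omega y0 = L.  Dyadic summation of the tail bounds
    gives (i); the bounds near 0 give (ii). *)

(** * Expectations of functions of [X = S^beta] *)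

Section stable_expectation.
Context (R : realType) (beta : R) (w : R -> R).
Hypothesis beta01 : 0 < beta < 1.
Hypothesis w_stable : is_stable_density beta w.
Local Notation leb := (@lebesgue_measure R).
Local Notation pos := (`]0%R, +oo[%classic : set R).

Implicit Types f g h : R -> R.

(* [Ex g] is the expectation of g(S^beta), S having density [w]. *)
Definition Ex (g : R -> R) : \bar R :=
  (\int[leb]_(u in pos) (g (u `^ beta) * w u)%:E)%E.

Lemma beta_gt0 : 0 < beta. Proof. by case/andP: beta01. Qed.
Hint Resolve beta_gt0 : core.
Lemma w_ge0 u : 0 < u -> 0 <= w u. Proof. by case: w_stable => h _; exact: h. Qed.

Lemma Ex_meas g : measurable_fun setT g ->
  measurable_fun pos (EFin \o (fun u : R => g (u `^ beta) * w u)).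
Proof.
move=> mg; apply/measurable_EFinP; apply: measurable_funM.
  by apply/measurable_funTS/measurableT_comp => //; exact: measurable_powR.
by case: w_stable => _ [].
Qed.

Lemma Ex_integrand_ge0 g : (forall x, 0 < x -> 0 <= g x) ->
  forall u, pos u -> (0 <= (g (u `^ beta) * w u)%:E)%E.
Proof.
move=> g0 u; rewrite /= in_itv/= andbT => u0.
by rewrite lee_fin mulr_ge0 ?w_ge0// g0// powR_gt0.
Qed.

Lemma Ex_ge0 g : (forall x, 0 < x -> 0 <= g x) -> (0 <= Ex g)%E.
Proof. by move=> g0; apply: integral_ge0 => u /(Ex_integrand_ge0 g0). Qed.

Lemma Ex_le g h : measurable_fun setT g -> measurable_fun setT h ->
  (forall x, 0 < x -> 0 <= g x) -> (forall x, 0 < x -> g x <= h x) ->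
  (Ex g <= Ex h)%E.
Proof.
move=> mg mh g0 gh; apply: ge0_le_integral => //.
- exact: Ex_integrand_ge0.
- exact: Ex_meas.
- exact: Ex_meas.
- move=> u; rewrite /= in_itv/= andbT => u0.
  by rewrite lee_fin ler_wpM2r ?w_ge0// gh// powR_gt0.
Qed.

Lemma Ex_D g h : measurable_fun setT g -> measurable_fun setT h ->
  (forall x, 0 < x -> 0 <= g x) -> (forall x, 0 < x -> 0 <= h x) ->
  Ex (fun x => g x + h x) = (Ex g + Ex h)%E.
Proof.
move=> mg mh g0 h0; rewrite /Ex -ge0_integralD//.
- by apply: eq_integral => u _; rewrite -EFinD mulrDl.
- exact: Ex_integrand_ge0.
- exact: Ex_meas.
- exact: Ex_integrand_ge0.
- exact: Ex_meas.
Qed.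

Lemma Ex_Z k g : measurable_fun setT g -> 0 <= k ->
  (forall x, 0 < x -> 0 <= g x) ->
  Ex (fun x => k * g x) = (k%:E * Ex g)%E.
Proof.
move=> mg k0 g0; rewrite /Ex -ge0_integralZl//.
- by apply: eq_integral => u _; rewrite -EFinM mulrA.
- exact: Ex_meas.
- exact: Ex_integrand_ge0.
Qed.

(* [ell y] is exp(- lambda S) in terms of X = S^beta, for lambda = y^(-1/beta). *)
Definition ell (y x : R) : R := expR (- ((x / y) `^ beta^-1)).

Lemma powRKV (x : R) : 0 <= x -> (x `^ beta) `^ beta^-1 = x.
Proof. by move=> x0; rewrite -powRrM mulfV ?gt_eqF// powRr1. Qed.

Lemma powRVK (x : R) : 0 <= x -> (x `^ beta^-1) `^ beta = x.
Proof. by move=> x0; rewrite -powRrM mulVf ?gt_eqF// powRr1. Qed.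

(** At [lambda = y^(-1/beta)] one has [lambda^beta = 1/y]. This identity and [Ex_1] contain all that
    is used of the Laplace transform. *)
Lemma Ex_ell y : 0 < y -> Ex (ell y) = (expR (- y^-1))%:E.
Proof.
move=> y0; have [_ [_ /(_ (y^-1 `^ beta^-1) (powR_ge0 _ _))]] := w_stable.
have yV0 : 0 <= y^-1 by rewrite invr_ge0 ltW.
rewrite (powRVK yV0) => <-.
apply: eq_integral => u; rewrite inE/= in_itv/= andbT => u0.
rewrite /ell powRM ?invr_ge0 ?powR_ge0 ?ltW// powRKV ?ltW//.
by congr (expR (- _) * _)%:E; rewrite mulrC.
Qed.

Lemma Ex_1 : Ex (fun=> 1) = 1%:E.
Proof.
have [_ [_ /(_ 0 (lexx _))]] := w_stable.
rewrite powR0 ?gt_eqF// oppr0 expR0 => <-.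
by apply: eq_integral => u _; rewrite mul0r oppr0 expR0.
Qed.

Lemma ell_gt0 y x : 0 < ell y x. Proof. exact: expR_gt0. Qed.
Lemma ell_le1 y x : ell y x <= 1.
Proof. by rewrite /ell -expR0 ler_expR oppr_le0 powR_ge0. Qed.

(* Expectations of such functions are finite, so they can be handled as reals by [Er]. *)
Definition bmeas (g : R -> R) := measurable_fun setT g /\
  exists k, forall x, 0 < x -> 0 <= g x <= k.

Definition Er g := fine (Ex g).

Lemma bmeas_ge0 g : bmeas g -> forall x, 0 < x -> 0 <= g x.
Proof. by case=> _ [k gk] x /gk /andP[]. Qed.

Lemma bmeasE g : bmeas g -> Ex g = (Er g)%:E.
Proof.
move=> [mg [k gk]]; rewrite fineK// ge0_fin_numE; last first.
  by apply: Ex_ge0 => x /gk /andP[].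
have k0 : 0 <= k by have /andP[/le_trans h /h] := gk 1 ltr01.
apply: (@le_lt_trans _ _ (Ex (fun=> k * 1))).
  by apply: Ex_le => // x /gk /andP[]//; rewrite mulr1.
by rewrite Ex_Z// Ex_1 mule1 ltry.
Qed.

Lemma bmeas_cst k : 0 <= k -> bmeas (fun=> k).
Proof. by move=> k0; split=> //; exists k => x _; rewrite k0 lexx. Qed.

Lemma bmeas_ell y : bmeas (ell y).
Proof.
split; last by exists 1 => x _; rewrite ltW ?ell_gt0 ?ell_le1.
apply: measurableT_comp => //; apply: measurableT_comp => //.
have mh : measurable_fun setT (fun x : R => x * y^-1) by exact: measurable_funM.
exact: (measurableT_comp (measurable_powR beta^-1) mh).
Qed.

Lemma bmeas_ind (A : set R) : measurable A -> bmeas \1_A.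
Proof.
move=> mA; split; first exact: measurable_indic.
by exists 1 => x _; rewrite indicE; case: (_ \in _); rewrite ?lexx ?ler01.
Qed.

Lemma bmeasD g h : bmeas g -> bmeas h -> bmeas (fun x => g x + h x).
Proof.
move=> [mg [k gk]] [mh [l hl]]; split; first exact: measurable_funD.
by exists (k + l) => x x0; move: (gk x x0) (hl x x0); lra.
Qed.

Lemma bmeasM g h : bmeas g -> bmeas h -> bmeas (fun x => g x * h x).
Proof.
move=> [mg [k gk]] [mh [l hl]]; split; first exact: measurable_funM.
exists (k * l) => x x0; move: (gk x x0) (hl x x0) => /andP[a b] /andP[a' b'].
by rewrite mulr_ge0//= ler_pM.
Qed.

Lemma bmeasZ k g : 0 <= k -> bmeas g -> bmeas (fun x => k * g x).
Proof. by move=> k0 bg; apply: bmeasM => //; exact: bmeas_cst. Qed.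

Lemma Er_le g h : bmeas g -> bmeas h -> (forall x, 0 < x -> g x <= h x) ->
  Er g <= Er h.
Proof.
move=> bg bh gh; rewrite -lee_fin -!bmeasE//; apply: Ex_le => //.
- by case: bg.
- by case: bh.
- exact: bmeas_ge0.
Qed.

Lemma ErD g h : bmeas g -> bmeas h -> Er (fun x => g x + h x) = Er g + Er h.
Proof.
move=> bg bh; apply: EFin_inj; rewrite -bmeasE; last exact: bmeasD.
rewrite Ex_D ?EFinD ?bmeasE//; try exact: bmeas_ge0.
- by case: bg.
- by case: bh.
Qed.

Lemma ErZ k g : 0 <= k -> bmeas g -> Er (fun x => k * g x) = k * Er g.
Proof.
move=> k0 bg; apply: EFin_inj; rewrite -bmeasE; last exact: bmeasZ.
rewrite Ex_Z ?EFinM ?bmeasE//; try exact: bmeas_ge0.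
by case: bg.
Qed.

Lemma Er_cst k : 0 <= k -> Er (fun=> k) = k.
Proof.
move=> k0; transitivity (Er (fun=> k * 1)); first by rewrite mulr1.
rewrite ErZ//; last exact: bmeas_cst.
by rewrite /Er Ex_1 /= mulr1.
Qed.

Lemma Er_ell y : 0 < y -> Er (ell y) = expR (- y^-1).
Proof. by move=> y0; rewrite /Er Ex_ell. Qed.

Lemma Er_ge0 g : bmeas g -> 0 <= Er g.
Proof. by move=> bg; rewrite -lee_fin -bmeasE//; apply/Ex_ge0/bmeas_ge0. Qed.

Lemma bmeas_affine g h k l m : bmeas g -> bmeas h -> 0 <= k -> 0 <= l -> 0 <= m ->
  bmeas (fun x => k + (l * g x + m * h x)).
Proof.
move=> bg bh k0 l0 m0.
exact: (bmeasD (bmeas_cst k0) (bmeasD (bmeasZ l0 bg) (bmeasZ m0 bh))).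
Qed.

Lemma Er_affine g h k l m : bmeas g -> bmeas h -> 0 <= k -> 0 <= l -> 0 <= m ->
  Er (fun x => k + (l * g x + m * h x)) = k + (l * Er g + m * Er h).
Proof.
move=> bg bh k0 l0 m0; have bk := bmeas_cst k0.
have bg' := bmeasZ l0 bg; have bh' := bmeasZ m0 bh.
rewrite -(ErZ l0 bg) -(ErZ m0 bh) -(ErD bg' bh') -[X in _ = X + _](Er_cst k0).
exact: (ErD bk (bmeasD bg' bh')).
Qed.

(** The device behind the probability estimates: a pointwise inequality between constants,
    indicators and functions [ell y] becomes one between probabilities and the explicit numbers
    [exp(-1/y)]. Shorter combinations are padded with weight 0. *)
Lemma Er_lin g1 g2 h1 h2 k0 k1 k2 l0 l1 l2 :
  bmeas g1 -> bmeas g2 -> bmeas h1 -> bmeas h2 ->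
  0 <= k0 -> 0 <= k1 -> 0 <= k2 -> 0 <= l0 -> 0 <= l1 -> 0 <= l2 ->
  (forall x, 0 < x -> k0 + (k1 * g1 x + k2 * g2 x) <= l0 + (l1 * h1 x + l2 * h2 x)) ->
  k0 + (k1 * Er g1 + k2 * Er g2) <= l0 + (l1 * Er h1 + l2 * Er h2).
Proof.
by move=> *; rewrite -!Er_affine//; apply: Er_le => //; exact: bmeas_affine.
Qed.

Lemma Ex_le_affine f g h k l m : measurable_fun setT f -> bmeas g -> bmeas h ->
  0 <= k -> 0 <= l -> 0 <= m -> (forall x, 0 < x -> 0 <= f x) ->
  (forall x, 0 < x -> f x <= k + (l * g x + m * h x)) ->
  (Ex f <= (k + (l * Er g + m * Er h))%:E)%E.
Proof.
move=> mf bg bh k0 l0 m0 f0 fg; have bgh := bmeas_affine bg bh k0 l0 m0.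
by rewrite -Er_affine// -bmeasE//; apply: Ex_le => //; case: bgh.
Qed.

Lemma Ex_ge_bmeas f g : measurable_fun setT f -> bmeas g ->
  (forall x, 0 < x -> g x <= f x) -> ((Er g)%:E <= Ex f)%E.
Proof.
move=> mf bg gf; rewrite -bmeasE//; apply: Ex_le => //; first by case: bg.
exact: bmeas_ge0.
Qed.

Lemma indic_itvE (i : interval R) x : \1_[set` i] x = (x \in i)%:R :> R.
Proof. by rewrite indicE; congr (nat_of_bool _)%:R; apply/idP/idP; rewrite inE. Qed.

Lemma bmeas_itv (i : interval R) : bmeas \1_[set` i].
Proof. by apply: bmeas_ind; exact: measurable_itv. Qed.

(** * Distribution of [X] at infinity and near 0 *)

Lemma expRN1_le2 : expR (-1) <= 2^-1 :> R.
Proof.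
by rewrite expRN lef_pV2 ?posrE ?expR_gt0// (le_trans _ (expR_ge1Dx 1)).
Qed.

Lemma betaV_gt1 : 1 < beta^-1.
Proof. by case/andP: beta01 => b0 b1; rewrite invf_gt1. Qed.

Lemma powR_ge1 (x p : R) : 1 <= x -> 0 <= p -> 1 <= x `^ p.
Proof. by move=> x1 p0; rewrite -(powRr0 x) ler_powR. Qed.

Lemma powR_le1 (x p : R) : 0 <= x <= 1 -> 0 <= p -> x `^ p <= 1.
Proof.
move=> /andP[x0 x1] p0; rewrite [leRHS](_ : 1 = 1 `^ p); last by rewrite powR1.
by apply: ge0_ler_powR; rewrite ?nnegrE.
Qed.

(** Markov's inequality for [1 - ell y]: it is at least 1/2 where [x > y], and its expectation
    [1 - exp(-1/y)] is at most [1/y]. *)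
Lemma tail_le y : 0 < y -> Er \1_`]y, +oo[ <= 2 / y.
Proof.
move=> y0.
have bi := bmeas_itv `]y, +oo[; have be := bmeas_ell y.
have := @Er_lin \1_`]y, +oo[ (ell y) (ell y) (ell y) 0 2^-1 1 1 0 0.
rewrite (Er_ell y0) => /(_ bi be be be) h.
have {h} : 0 + (2^-1 * Er \1_`]y, +oo[ + 1 * expR (- y^-1)) <=
    1 + (0 * expR (- y^-1) + 0 * expR (- y^-1)).
  apply: h; try lra.
  move=> x x0; rewrite indic_itvE in_itv/= andbT.
  have := ell_le1 y x.
  have [yx|xy] := ltP y x => /= ly; last by lra.
  have : ell y x <= 2^-1; last by lra.
  rewrite (le_trans _ expRN1_le2)// ler_expR lerN2 powR_ge1 ?invr_ge0 ?ltW//.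
  by rewrite ltr_pdivlMr ?mul1r.
by have := expR_ge1Dx (- y^-1); lra.
Qed.

(** Follows from [exp(-v) <= 1/(1+v) <= 1 - v/2]. *)
Lemma expRN_ge_half (v : R) : 0 <= v <= 1 -> v <= 2 * (1 - expR (- v)).
Proof.
move=> /andP[v0 v1]; have := expR_ge1Dx v; rewrite expRN => h.
have e0 : 0 < expR v by exact: expR_gt0.
have : (expR v)^-1 <= (1 + v)^-1 by rewrite lef_pV2 ?posrE//; lra.
have : (1 + v)^-1 <= 1 - v / 2.
  by rewrite -[leLHS]mul1r ler_pdivrMr; nra.
lra.
Qed.

(** Two Laplace parameters are compared. The expectation of [1 - ell (y/dl)] is at least [dl/(2y)],
    while the event [X <= y] contributes at most [2 eps (1 - exp(-1/y)) <= dl/(4y)] to it; the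
    remaining [dl/(4y)] must come from [X > y]. *)
Lemma tail_ge : exists2 kap : R, 0 < kap & forall y, 1 <= y ->
  kap / y <= Er \1_`]y, +oo[.
Proof.
have [dl [eps [dl0 dl1 epsE dlq]]] : exists dl eps : R,
    [/\ 0 < dl, dl <= 1, eps = dl `^ beta^-1 & eps = dl * 8^-1].
  have q1 : 0 < beta^-1 - 1 by have := betaV_gt1; lra.
  (* Solves [dl^(1/beta) = dl/8]. This is possible with [dl <= 1] because [1/beta > 1]: shrinking
     [x] by [dl] shrinks the exponent of [ell] by a smaller factor still. *)
  pose dl : R := 8^-1 `^ (beta^-1 - 1)^-1.
  have dl0 : 0 < dl by rewrite powR_gt0// invr_gt0.
  exists dl, (dl `^ beta^-1); split => //.
    by apply: powR_le1; [lra|rewrite invr_ge0 ltW].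
  rewrite -[in LHS](subrK 1 beta^-1) addrC powRD; last by rewrite (gt_eqF dl0) implybT.
  by rewrite (powRr1 (ltW dl0)) /dl -powRrM mulVf ?gt_eqF// powRr1//; lra.
have eps0 : 0 < eps by rewrite epsE powR_gt0.
exists (dl / 4); first by lra.
move=> y y1; have y0 : 0 < y by lra.
have e20 : 0 <= 2 * eps by lra.
have bi := bmeas_itv `]y, +oo[.
have be := bmeas_ell.
have ydl0 := divr_gt0 y0 dl0.
(* For x <= y, with v = (x/y)^(1/beta) <= 1, this is
   1 - exp(-eps v) <= eps v <= 2 eps (1 - exp(-v)). *)
have pw x : 0 < x -> 1 + (2 * eps * ell y x + 0 * ell y x) <=
    2 * eps + (1 * \1_`]y, +oo[ x + 1 * ell (y / dl) x).
  move=> x0; rewrite indic_itvE in_itv/= andbT.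
  have [yx|xy] := ltP y x => /=.
    have := ell_gt0 (y / dl) x.
    have : 2 * eps * ell y x <= 2 * eps by rewrite ler_piMr ?ell_le1.
    by move: (ell y x) (ell (y / dl) x) => a b; lra.
  have [v vE] : exists v, v = (x / y) `^ beta^-1 by exists ((x / y) `^ beta^-1).
  have v01 : 0 <= v <= 1.
    rewrite vE powR_ge0/= powR_le1//; last by rewrite invr_ge0 ltW.
    by rewrite divr_ge0 ?(ltW x0) ?(ltW y0)//= ler_pdivrMr ?mul1r.
  have -> : ell (y / dl) x = expR (- (eps * v)).
    rewrite /ell invf_div mulrA mulrAC (powRM _ (ltW (divr_gt0 x0 y0)) (ltW dl0)).
    by rewrite -vE -epsE mulrC.
  rewrite (_ : ell y x = expR (- v)); last by rewrite vE.
  have := expRN_ge_half v01; have := expR_ge1Dx (- (eps * v)); nra.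
have := Er_lin (be y) (be y) bi (be (y / dl)) ler01 e20 (lexx 0) e20 ler01 ler01 pw.
rewrite (Er_ell y0) (Er_ell ydl0) invf_div.
have := expR_ge1Dx (- y^-1).
have yV0 : 0 < y^-1 by rewrite invr_gt0.
have yV1 : y^-1 <= 1 by rewrite invf_le1.
have : dl / y <= 2 * (1 - expR (- (dl / y))) by apply: expRN_ge_half; nra.
rewrite dlq; nra.
Qed.

(** Subtract the upper tail bound at [M y] from the lower one at [y]; [M] is large enough that [2/M]
    is at most half the constant of [tail_ge]. *)
Lemma tail_block : exists kap M : R, [/\ 0 < kap, 2 <= M &
  forall y, 1 <= y -> kap / y <= Er \1_`]y, M * y]].
Proof.
have [kap kap0 hk] := tail_ge.
pose M := 2 + 4 / kap.
have M2 : 2 <= M by rewrite lerDl divr_ge0// ltW.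
have Mk : 4 <= M * kap by rewrite mulrDl divfK ?gt_eqF//; nra.
exists (kap / 2), M; split => //; first by lra.
move=> y y1; have y0 : 0 < y by lra.
have bi i := bmeas_itv i.
have := @Er_lin \1_`]y, +oo[ \1_`]y, +oo[ \1_`]y, M * y] \1_`](M * y), +oo[ 0 1 0 0 1 1
  (bi _) (bi _) (bi _) (bi _).
move=> h; have {h} : 0 + (1 * Er \1_`]y, +oo[ + 0 * Er \1_`]y, +oo[) <=
    0 + (1 * Er \1_`]y, M * y] + 1 * Er \1_`](M * y), +oo[).
  apply: h => // x _; rewrite !indic_itvE !in_itv/= !andbT.
  have [yx|xy] := ltP y x; have [xM|xM] := leP x (M * y) => /=; lra.
have : Er \1_`](M * y), +oo[ <= 2 / (M * y) by apply: tail_le; nra.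
have := hk _ y1.
have -> : 2 / (M * y) = (2 / M) / y by rewrite invfM mulrA.
have : 2 / M <= kap / 2 by rewrite ler_pdivrMr; lra.
have yV0 : 0 < y^-1 by rewrite invr_gt0.
nra.
Qed.

(** The relation between [L] and [y0] says [(L y0)^(1/beta) = L]. For [x <= y0/4] the exponent
    [(4 L x)^(1/beta)] is therefore at most [L], so this multiple of [ell] dominates the indicator
    of [x <= y0/4]. *)
Lemma ell_small (L y0 x : R) : 0 < L -> 0 < y0 -> L * y0 = L `^ beta ->
  0 < x -> x <= y0 / 4 -> 1 <= expR L * ell (4 * L)^-1 x.
Proof.
move=> L0 y00 Ly x0 xy; rewrite /ell -expRD.
apply: le_trans (expR_ge1Dx _); rewrite lerDl subr_ge0 invrK.
rewrite -[leRHS](powRKV (ltW L0)) -Ly.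
have bV0 : 0 <= beta^-1 by have := betaV_gt1; lra.
by apply: ge0_ler_powR; rewrite ?nnegrE//; nra.
Qed.

(** Here the exponent [(L x)^(1/beta)] is at least [2^(1/beta) L >= 2 L], again since
    [1/beta > 1]. *)
Lemma ell_large (L y0 x : R) : 0 < L -> 0 < y0 -> L * y0 = L `^ beta ->
  2 * y0 <= x -> ell L^-1 x <= expR (- (2 * L)).
Proof.
move=> L0 y00 Ly yx; rewrite /ell ler_expR lerN2 invrK.
have bV0 : 0 <= beta^-1 by have := betaV_gt1; lra.
have h2 : 2 <= 2 `^ beta^-1 :> R by apply: le1r_powR; [lra|exact/ltW/betaV_gt1].
apply: (@le_trans _ _ (2 `^ beta^-1 * L)); first by nra.
have Ly0 : 0 <= L * y0 by nra.
rewrite -{1}(powRKV (ltW L0)) -Ly -(powRM _ _ Ly0)//.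
by apply: ge0_ler_powR; rewrite ?nnegrE//; nra.
Qed.

(** Of the total [exp(-L)], the expectation of [ell L^-1], the part from [x > 2 y0] is at most
    [exp(-2L)] by [ell_large], and the part from [x <= y0/4] at most [exp(L) exp(-4L)] by
    [ell_small]. With [q = exp(-L) <= 1/2], what remains is at least [q (1 - q - q^2) >= q/4]. *)
Lemma small_ball (L y0 : R) : 1 <= L -> 0 < y0 -> L * y0 = L `^ beta ->
  expR (- L) / 4 <= Er \1_`](y0 / 4), (2 * y0)].
Proof.
move=> L1 y00 Ly; have L0 : 0 < L by lra.
set A := `](y0 / 4), (2 * y0)].
have eL0 : 0 < expR L by exact: expR_gt0.
have be := bmeas_ell; have bA := bmeas_itv A.
have LV0 : 0 < L^-1 by rewrite invr_gt0.
have L4V0 : 0 < (4 * L)^-1 by rewrite invr_gt0; lra.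
have pw x : 0 < x -> 0 + (1 * ell L^-1 x + 0 * ell L^-1 x) <=
    expR (- (2 * L)) + (1 * \1_[set` A] x + expR L * ell (4 * L)^-1 x).
  move=> x0; rewrite indic_itvE in_itv/=.
  have e2 : 0 < expR (- (2 * L)) by exact: expR_gt0.
  have t0 := ell_gt0 (4 * L)^-1 x.
  have l1 := ell_le1 L^-1 x.
  have [xs|xs] := ltP (y0 / 4) x => /=; last first.
    have := ell_small L0 y00 Ly x0 xs.
    by move: (expR L * _) (ell L^-1 x) l1 => a b; lra.
  have : 0 < expR L * ell (4 * L)^-1 x by rewrite mulr_gt0.
  have [xb|xb] := leP x (2 * y0) => /=.
    by move: (expR L * _) (ell L^-1 x) l1 => a b; lra.
  suff : ell L^-1 x <= expR (- (2 * L)).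
    by move: (expR L * _) (ell L^-1 x) l1 => a b; lra.
  exact: ell_large L0 y00 Ly (ltW xb).
have e2 := expR_ge0 (- (2 * L)).
have := Er_lin (be _) (be _) bA (be _) (lexx 0) ler01 (lexx 0) e2 ler01 (ltW eL0) pw.
rewrite (Er_ell LV0) (Er_ell L4V0) !invrK.
rewrite mul0r addr0 add0r !mul1r.
rewrite -expRD.
have h : expR (- L) <= 2^-1.
  by rewrite (le_trans _ expRN1_le2)// ler_expR; lra.
have p : 0 < expR (- L) by exact: expR_gt0.
have -> : expR (- (2 * L)) = expR (- L) * expR (- L) by rewrite -expRD; congr expR; lra.
have -> : expR (L - 4 * L) = expR (- L) * expR (- L) * expR (- L).
  by rewrite -!expRD; congr expR; lra.
by nra.
Qed.

End stable_expectation.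

(** * The kernel [x^p exp(-a x)] *)

Section gamma_kernel.
Context (R : realType).
Implicit Types (p a x M z : R).

(** With [p = d/2] and [a = K Omega] this is, up to a power of [t], a Gaussian bound at time
    [t^beta z] written in [x = 1/z]; see [heat_kernelE]. *)
Definition gker p a x : R := x `^ p * expR (- (a * x)).

Lemma measurable_gker p a : measurable_fun setT (gker p a).
Proof.
apply: measurable_funM; first exact: measurable_powR.
by apply: measurableT_comp => //; apply: measurableT_comp.
Qed.

Lemma gker_ge0 p a x : 0 <= gker p a x.
Proof. by rewrite mulr_ge0 ?powR_ge0 ?expR_ge0. Qed.

(** In the variable [z = x/(p/a)] the claim is [z^p exp(-p z) <= 1], that is [ln z <= z]. *)
Lemma gker_le p a x : 0 < p -> 0 < a -> 0 < x -> gker p a x <= (p / a) `^ p.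
Proof.
move=> p0 a0 x0; have pa0 : 0 < p / a by rewrite divr_gt0.
have z0 : 0 < x / (p / a) by rewrite divr_gt0.
have xE : x = x / (p / a) * (p / a) by rewrite divfK ?gt_eqF.
rewrite /gker {1}xE (powRM _ (ltW z0) (ltW pa0)).
rewrite mulrAC ler_piMl ?powR_ge0// /powR (gt_eqF z0) -expRD -[leRHS]expR0 ler_expR.
have := ltW (ln_sublinear z0); move: (ln _) => l lz.
have -> : a * x = p * (x / (p / a)) by field; rewrite !gt_eqF.
by rewrite -mulrBr pmulr_rle0// subr_le0.
Qed.

Lemma exists_expr M z : 2 <= M -> 1 <= z -> exists N : nat, M ^+ N <= z < M ^+ N.+1.
Proof.
move=> M2 z1; have hex : exists n, z < M ^+ n.
  exists (Num.bound z); have z0 : 0 <= z by lra.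
  apply: (lt_trans (archi_boundP z0)).
  apply: (@lt_le_trans _ _ (2 ^+ Num.bound z)); last by rewrite lerXn2r ?nnegrE//; lra.
  by rewrite -natrX ltr_nat ltn_expl.
case: (ex_minnP hex) => -[|n] zn nmin; first by move: zn; rewrite expr0; lra.
exists n; rewrite zn andbT leNgt; apply/negP => /nmin.
by rewrite ltnn.
Qed.

Lemma powR_expr (r s : R) (n : nat) : 0 <= r -> (r ^+ n) `^ s = (r `^ s) ^+ n.
Proof.
by move=> r0; rewrite -(powR_mulrn n r0) -(powR_mulrn n (powR_ge0 r s)) powRAC.
Qed.

End gamma_kernel.

(** * Two-sided bounds for [E[X^p exp(-K Omega X)]] *)

Section stable_moments.
Context (R : realType) (beta : R) (w : R -> R).
Hypothesis beta01 : 0 < beta < 1.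
Hypothesis w_stable : is_stable_density beta w.
Local Notation Ex := (@Ex R beta w).
Local Notation Er := (@Er R beta w).
Local Notation pos := (`]0%R, +oo[%classic : set R).
Implicit Types (p a K Om L : R).

Let mk p a := @measurable_gker R p a.

Lemma Ex_gker_ge_itv p a k (i : interval R) : 0 <= k ->
  (forall x, 0 < x -> x \in i -> k <= gker p a x) ->
  ((k * Er \1_[set` i])%:E <= Ex (gker p a))%E.
Proof.
move=> k0 hk; rewrite -(ErZ beta01 w_stable k0 (bmeas_itv i)).
apply: (Ex_ge_bmeas beta01 w_stable (mk p a) (bmeasZ k0 (bmeas_itv i))) => x x0.
rewrite (indic_itvE i x); have [xi|xi] := boolP (x \in i); first by rewrite mulr1 hk.
by rewrite mulr0 gker_ge0.
Qed.

(** Half of the exponential absorbs [x^p], leaving [D exp(-a x/2)]. For [x > y0/4] this is at most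
    [D exp(-K L/8)]; for [x <= y0/4] it is dominated through [ell_small], whose expectation is
    [exp(L - 4L)]. Hence the rate [min(3, K/8)]. *)
Lemma Ex_gker_large_le p K : 0 < p -> 0 < K -> exists C c : R, [/\ 0 < C, 0 < c &
  forall Om L y0, 1 <= L -> 0 < y0 -> L * y0 = L `^ beta -> Om * y0 = L ->
  (Ex (gker p (K * Om)) <= (C * y0 `^ p * expR (- (c * L)))%:E)%E].
Proof.
move=> p0 K0; pose c := Num.min 3 (K / 8).
exists (2 * (2 * p / K) `^ p), c; split.
- by rewrite mulr_gt0// powR_gt0// divr_gt0// mulr_gt0.
- by rewrite lt_min; apply/andP; split; lra.
move=> Om L y0 L1 y00 Ly Oy; have L0 : 0 < L by lra.
have Om0 : 0 < Om by rewrite -(pmulr_lgt0 _ y00) Oy.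
set a := K * Om; have a0 : 0 < a by rewrite mulr_gt0.
set D := (2 * p / a) `^ p; have D0 : 0 <= D by exact: powR_ge0.
have be := bmeas_ell; have e0 := expR_ge0 (- (K * L / 8)).
have DL0 : 0 <= D * expR L by rewrite mulr_ge0 ?expR_ge0.
have De0 : 0 <= D * expR (- (K * L / 8)) by rewrite mulr_ge0.
have pw x : 0 < x -> gker p a x <= D * expR (- (K * L / 8)) +
    (D * expR L * ell beta (4 * L)^-1 x + 0 * ell beta (4 * L)^-1 x).
  move=> x0.
  have gD : gker p a x <= D * expR (- (a * x / 2)).
    have a20 : 0 < a / 2 by lra.
    have -> : gker p a x = gker p (a / 2) x * expR (- (a * x / 2)).
      by rewrite /gker -[RHS]mulrA -expRD; congr (_ * expR _); lra.
    rewrite ler_wpM2r ?expR_ge0// (le_trans (gker_le p0 a20 x0))//.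
    rewrite /D (_ : p / (a / 2) = 2 * p / a)//.
    by field; rewrite gt_eqF.
  apply: (le_trans gD); rewrite mul0r addr0 -[X in _ <= _ + X]mulrA -mulrDr ler_wpM2l//.
  have l0 : 0 < expR L * ell beta (4 * L)^-1 x by rewrite mulr_gt0 ?expR_gt0 ?ell_gt0.
  have [xs|xs] := leP x (y0 / 4).
    apply: (@le_trans _ _ 1).
      rewrite -[leRHS]expR0 ler_expR oppr_le0; nra.
    apply: (le_trans (ell_small beta01 L0 y00 Ly x0 xs)).
    by rewrite lerDr.
  apply: (@le_trans _ _ (expR (- (K * L / 8)))); last by rewrite lerDl ltW.
  by rewrite ler_expR lerN2 -Oy; have := ler_wpM2l (ltW a0) (ltW xs); rewrite /a; lra.
apply: (le_trans (Ex_le_affine beta01 w_stable (mk p a) (be _ _ _) (be _ _ _) De0 DL0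
  (lexx 0) (fun x _ => gker_ge0 p a x) pw)).
have L4 : 0 < (4 * L)^-1 by rewrite invr_gt0; lra.
rewrite (Er_ell beta01 w_stable L4) invrK mul0r addr0 lee_fin.
rewrite -[X in _ + X <= _]mulrA -expRD -mulrDr.
apply: (@le_trans _ _ (D * (2 * expR (- (c * L))))).
  rewrite ler_wpM2l//.
  have : expR (- (K * L / 8)) <= expR (- (c * L)).
    rewrite ler_expR lerN2 [leRHS]mulrAC ler_wpM2r ?(ltW L0)//.
    by rewrite /c ge_min lexx orbT.
  have : expR (L + - (4 * L)) <= expR (- (c * L)).
    have : c * L <= 3 * L by rewrite ler_wpM2r ?(ltW L0)// /c ge_min lexx.
    by rewrite ler_expR; lra.
  by lra.
rewrite mulrCA !mulrA ler_wpM2r ?expR_ge0// -!mulrA ler_wpM2l// mulrA.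
(* The factor [Om^(-p)] inside [D] is at most [y0^p], since [Om y0 = L >= 1]. *)
have -> : D = (2 * p / K) `^ p * Om^-1 `^ p.
  rewrite -powRM ?invr_ge0 ?divr_ge0 ?mulr_ge0 ?ltW//; congr (_ `^ _).
  by rewrite /a invfM mulrA.
rewrite ler_wpM2l ?powR_ge0//.
apply: ge0_ler_powR; rewrite ?nnegrE ?invr_ge0 ?(ltW Om0) ?(ltW y00) ?(ltW p0)//.
by rewrite -[leLHS]mul1r ler_pdivrMr// mulrC Oy.
Qed.

(** Keep only [y0/4 < X <= 2 y0]. There the kernel is at least [(y0/4)^p exp(-2 K L)], and by
    [small_ball] the event has probability at least [exp(-L)/4]; this gives the rate [2 K + 1]. *)
Lemma Ex_gker_large_ge p K : 0 < p -> 0 < K -> exists C c : R, [/\ 0 < C, 0 < c &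
  forall Om L y0, 1 <= L -> 0 < y0 -> L * y0 = L `^ beta -> Om * y0 = L ->
  ((C * y0 `^ p * expR (- (c * L)))%:E <= Ex (gker p (K * Om)))%E].
Proof.
move=> p0 K0; exists (4^-1 `^ p / 4), (2 * K + 1).
split; [by rewrite divr_gt0// powR_gt0|lra|].
move=> Om L y0 L1 y00 Ly Oy; have L0 : 0 < L by lra.
have Om0 : 0 < Om by rewrite -(pmulr_lgt0 _ y00) Oy.
set a := K * Om; have a0 : 0 < a by rewrite mulr_gt0.
pose k := (y0 / 4) `^ p * expR (- (2 * K * L)).
have k0 : 0 <= k by rewrite mulr_ge0 ?powR_ge0 ?expR_ge0.
have h x : 0 < x -> x \in `](y0 / 4), (2 * y0)] -> k <= gker p a x.
  move=> x0; rewrite in_itv/= => /andP[yx xy].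
  rewrite ler_pM ?powR_ge0 ?expR_ge0//.
    apply: ge0_ler_powR; rewrite ?nnegrE ?(ltW p0) ?(ltW x0) ?(ltW yx)//; lra.
  by rewrite ler_expR lerN2 -Oy; have := ler_wpM2l (ltW a0) xy; rewrite /a; lra.
apply: le_trans (Ex_gker_ge_itv k0 h); rewrite lee_fin.
have := ler_wpM2l k0 (small_ball beta01 w_stable L1 y00 Ly).
apply: le_trans; rewrite /k (powRM _ (ltW y00)) ?invr_ge0//.
rewrite (_ : - ((2 * K + 1) * L) = - (2 * K * L) - L); last by lra.
by rewrite expRD; lra.
Qed.

(** The previous bound at [Om = L = y0 = 1], extended to smaller [Om] because the kernel decreases
    in [Om]. *)
Lemma Ex_gker_ge_cst p K : 0 < p -> 0 < K -> exists2 C : R, 0 < C &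
  forall Om, 0 <= Om <= 1 -> (C%:E <= Ex (gker p (K * Om)))%E.
Proof.
move=> p0 K0; have [C [c [C0 c0 h]]] := Ex_gker_large_ge p0 K0.
exists (C * expR (- c)); first by rewrite mulr_gt0// expR_gt0.
move=> Om /andP[Om0 Om1]; have := h 1 1 1 (lexx _) ltr01.
rewrite !powR1 !mulr1 => /(_ erefl erefl) {}h.
apply: (le_trans h); apply: (Ex_le w_stable (mk p K) (mk p (K * Om))).
  by move=> x x0; exact: gker_ge0.
move=> x x0; rewrite /gker ler_wpM2l ?powR_ge0// ler_expR lerN2.
by rewrite ler_wpM2r ?(ltW x0)// ler_piMr// ltW.
Qed.

(** * Dyadic summation for [Omega <= 1] *)

Definition tpow p (N : nat) (x : R) := x `^ p * \1_`]-oo, (2 ^+ N)] x.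

Lemma bmeas_tpow p N : 0 < p -> bmeas (tpow p N).
Proof.
move=> p0; split.
  apply: measurable_funM; first exact: measurable_powR.
  by case: (bmeas_itv `]-oo, (2 ^+ N : R)]).
exists ((2 ^+ N) `^ p) => x x0; rewrite /tpow indic_itvE in_itv/=.
have [xN|xN] := leP x (2 ^+ N) => /=; last by rewrite mulr0 lexx powR_ge0.
rewrite mulr1 powR_ge0/=; apply: ge0_ler_powR; rewrite ?nnegrE ?(ltW p0) ?(ltW x0)//.
Qed.

(** The range [X <= 1] contributes at most 1. The block from [2^n] to [2^(n+1)] contributes at most
    [(2 2^n)^p P(X > 2^n)], which [tail_le] bounds by the n-th term of the geometric sum. *)
Lemma Er_tpow_le p N : 0 < p ->
  Er (tpow p N) <= 1 + 2 * 2 `^ p * \sum_(n < N) (2 `^ (p - 1)) ^+ n.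
Proof.
move=> p0; elim: N => [|N ih].
  rewrite big_ord0 mulr0 addr0 -[leRHS](Er_cst beta01 w_stable ler01).
  apply: (Er_le beta01 w_stable (bmeas_tpow _ p0) (bmeas_cst ler01)) => x x0.
  rewrite /tpow indic_itvE in_itv/= expr0.
  have [x1|x1] := leP x 1 => /=; last by rewrite mulr0.
  by rewrite mulr1; apply: powR_le1; [lra|exact: ltW].
have N0 : 0 < 2 ^+ N :> R by rewrite exprn_gt0.
have D0 : 0 <= (2 * 2 ^+ N) `^ p :> R by exact: powR_ge0.
have bt := bmeas_tpow N p0; have bt' := bmeas_tpow N.+1 p0.
have bi := bmeas_itv `](2 ^+ N : R), +oo[.
have pw x : 0 < x -> 0 + (1 * tpow p N.+1 x + 0 * tpow p N.+1 x) <=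
    0 + (1 * tpow p N x + (2 * 2 ^+ N) `^ p * \1_`](2 ^+ N), +oo[ x).
  move=> x0; rewrite mul0r addr0 !add0r !mul1r.
  rewrite /tpow !indic_itvE !in_itv/= andbT exprS.
  have [xN|xN] := leP x (2 ^+ N).
    rewrite (le_trans xN) /= ?mulr0 ?addr0//; lra.
  rewrite !mulr0 add0r mulr1; have [xN'|xN'] := leP x (2 * 2 ^+ N).
    by rewrite mulr1; apply: ge0_ler_powR; rewrite ?nnegrE ?(ltW p0) ?(ltW x0)//; lra.
  by rewrite mulr0.
have := Er_lin beta01 w_stable bt' bt' bt bi (lexx 0) ler01 (lexx 0) (lexx 0) ler01 D0 pw.
rewrite mul0r addr0 !add0r !mul1r => h; apply: (le_trans h).
rewrite big_ord_recr /= mulrDr addrA lerD//.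
have := ler_wpM2l D0 (tail_le beta01 w_stable N0) => /le_trans; apply.
rewrite (powRM _ _ (ltW N0))// -powR_expr//.
rewrite powRB; last by rewrite (gt_eqF N0) implybT.
by rewrite (powRr1 (ltW N0)); lra.
Qed.

(** Below [2^N] the exponential is dropped; above it the kernel is replaced by its bound [(p/a)^p]
    and [tail_le] is applied. *)
Lemma Ex_gker_le_tpow p a N : 0 < p -> 0 < a ->
  (Ex (gker p a) <= (1 + 2 * 2 `^ p * \sum_(n < N) (2 `^ (p - 1)) ^+ n
     + (p / a) `^ p * (2 / 2 ^+ N))%:E)%E.
Proof.
move=> p0 a0; have N0 : 0 < 2 ^+ N :> R by rewrite exprn_gt0.
have bt := bmeas_tpow N p0; have bi := bmeas_itv `](2 ^+ N : R), +oo[.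
have D0 : 0 <= (p / a) `^ p by exact: powR_ge0.
have pw x : 0 < x -> gker p a x <=
    0 + (1 * tpow p N x + (p / a) `^ p * \1_`](2 ^+ N), +oo[ x).
  move=> x0; rewrite add0r mul1r /tpow !indic_itvE !in_itv/= andbT.
  have [xN|xN] := leP x (2 ^+ N) => /=; last first.
    by rewrite mulr0 add0r mulr1 gker_le.
  rewrite mulr1 mulr0 addr0 /gker ler_piMr ?powR_ge0// -[leRHS]expR0 ler_expR.
  by rewrite oppr_le0 mulr_ge0 ?(ltW a0) ?(ltW x0).
apply: (le_trans (Ex_le_affine beta01 w_stable (mk p a) bt bi (lexx 0) ler01 D0
  (fun x _ => gker_ge0 p a x) pw)).
rewrite lee_fin add0r mul1r lerD ?Er_tpow_le// ler_wpM2l//.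
exact: (tail_le beta01 w_stable N0).
Qed.

(** Monotone convergence for truncations that reach [f] at each point after finitely many steps. *)
Lemma Ex_lim_le (g : nat -> R -> R) (f : R -> R) (C : \bar R) :
  (forall n, measurable_fun setT (g n)) ->
  (forall n x, 0 < x -> 0 <= g n x) ->
  (forall x n m, 0 < x -> (n <= m)%N -> g n x <= g m x) ->
  (forall x, 0 < x -> exists N, forall n, (N <= n)%N -> g n x = f x) ->
  (forall n, (Ex (g n) <= C)%E) -> (Ex f <= C)%E.
Proof.
move=> mg g0 ndg gf gC.
pose G n (u : R) := (g n (u `^ beta) * w u)%:E.
have mG n : measurable_fun pos (G n) by exact: (Ex_meas w_stable (mg n)).
have G0 n u : pos u -> (0 <= G n u)%E.
  by apply: (Ex_integrand_ge0 w_stable) => x; exact: g0.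
have ndG u : pos u -> nondecreasing_seq (G ^~ u).
  rewrite /= in_itv/= andbT => u0 n m nm.
  by rewrite lee_fin ler_wpM2r ?(w_ge0 w_stable)// ndg// powR_gt0.
have -> : Ex f = (\int[lebesgue_measure]_(u in `]0%R, +oo[) limn (G ^~ u))%E.
  apply: eq_integral => u; rewrite inE/= in_itv/= andbT => u0.
  have [N hN] := gf _ (powR_gt0 beta u0).
  apply/esym/cvg_lim => //; apply: cvg_near_cst.
  by exists N => // n /= Nn; rewrite /G hN.
have -> : (\int[lebesgue_measure]_(u in pos) limn (G ^~ u))%E = limn (fun n => Ex (g n)).
  have mpos : measurable pos by exact: measurable_itv.
  exact: (@monotone_convergence _ _ _ lebesgue_measure pos mpos G mG G0 ndG).
apply: lime_le; last by apply: nearW => n; exact: gC.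
apply: ereal_nondecreasing_is_cvgn => n m nm; apply: ge0_le_integral => //.
- by move=> u; exact: G0.
- exact: mG.
- exact: mG.
- by move=> u u0; exact: (ndG u u0 n m nm).
Qed.

Lemma gt1_ltr_powR (a x y : R) : 1 < a -> x < y -> a `^ x < a `^ y.
Proof.
move=> a1 xy; have a0 : 0 < a by lra.
by rewrite /powR (gt_eqF a0) ltr_expR ltr_pM2r// ln_gt0.
Qed.

(** For [p < 1] the ratio [2^(p-1)] is below 1, so the truncated moments are bounded uniformly.
    Passing to the limit also covers [a = 0], where [gker_le] gives nothing. *)
Lemma Ex_gker_le_cst p : 0 < p -> p < 1 -> exists2 C : R, 0 < C &
  forall a, 0 <= a -> (Ex (gker p a) <= C%:E)%E.
Proof.
move=> p0 p1; set rho : R := 2 `^ (p - 1).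
have rho0 : 0 < rho by rewrite powR_gt0.
have rho1 : rho < 1.
  rewrite /rho (_ : p - 1 = - (1 - p)); last by lra.
  rewrite powRN invf_lt1 ?powR_gt0// -[ltLHS](powRr0 2).
  by apply: gt1_ltr_powR; lra.
have geo N : \sum_(n < N) rho ^+ n <= (1 - rho)^-1.
  have := geometric_le_lim N ler01 rho0; rewrite ger0_norm ?(ltW rho0)// mul1r => /(_ rho1).
  by rewrite -exprn_geometric /series/= big_mkord.
have t0 : 0 < 2 `^ p :> R by rewrite powR_gt0.
have c0 : 0 < (1 - rho)^-1 by rewrite invr_gt0; lra.
exists (1 + 2 * 2 `^ p * (1 - rho)^-1); first by nra.
move=> a a0; apply: (@Ex_lim_le (fun n x => tpow p n x * expR (- (a * x)))).
- move=> n; apply: measurable_funM; first by case: (bmeas_tpow n p0).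
  by apply: measurableT_comp => //; apply: measurableT_comp.
- by move=> n x x0; rewrite mulr_ge0 ?expR_ge0// (bmeas_ge0 (bmeas_tpow n p0)).
- move=> x n m x0 nm; rewrite ler_wpM2r ?expR_ge0// /tpow ler_wpM2l ?powR_ge0//.
  rewrite !indic_itvE !in_itv/= ler_nat.
  have [xn|] := leP x (2 ^+ n) => //=.
  by rewrite (le_trans xn)// ler_eXn2l// ltr1n.
- move=> x x0; exists (Num.bound x) => n Nn; rewrite /tpow indic_itvE in_itv/=.
  rewrite (_ : x <= 2 ^+ n) ?mulr1//; apply/ltW.
  apply: (lt_le_trans (archi_boundP (ltW x0))).
  by rewrite -natrX ler_nat (leq_trans Nn)// ltnW// ltn_expl.
move=> n; apply: (@le_trans _ _ (Er (tpow p n))%:E); last first.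
  rewrite lee_fin (le_trans (Er_tpow_le n p0))// lerD2l.
  by rewrite ler_wpM2l// mulr_ge0 ?(ltW t0).
rewrite -(bmeasE beta01 w_stable (bmeas_tpow n p0)); apply: (Ex_le w_stable).
- apply: measurable_funM; first by case: (bmeas_tpow n p0).
  by apply: measurableT_comp => //; apply: measurableT_comp.
- by case: (bmeas_tpow n p0).
- by move=> x x0; rewrite mulr_ge0 ?expR_ge0// (bmeas_ge0 (bmeas_tpow n p0)).
- move=> x x0; rewrite ler_piMr ?(bmeas_ge0 (bmeas_tpow n p0))//.
  by rewrite -[leRHS]expR0 ler_expR oppr_le0 mulr_ge0 ?(ltW x0).
Qed.

(** Each block from [M^n] to [M^(n+1)] adds at least [M^n (kap / M^n) = kap] to the truncated mean.
    This is the source of the logarithm when [d = 2]. *)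
Lemma Er_lin_block_ge (kap M : R) N : 0 < kap -> 2 <= M ->
  (forall y, 1 <= y -> kap / y <= Er \1_`]y, M * y]) ->
  bmeas (fun x => x * \1_`](1 : R), (M ^+ N)] x) /\
  kap * N%:R <= Er (fun x => x * \1_`](1 : R), (M ^+ N)] x).
Proof.
move=> kap0 M2 hb.
have bm n : bmeas (fun x => x * \1_`](1 : R), (M ^+ n)] x).
  split; first by apply: measurable_funM => //; case: (bmeas_itv `](1 : R), (M ^+ n)]).
  exists (M ^+ n) => x x0; rewrite indic_itvE in_itv/=.
  have Mn0 : 0 <= M ^+ n by rewrite exprn_ge0//; lra.
  have [x1|x1] := ltP 1 x => /=; last by rewrite mulr0 lexx.
  by have [xM|xM] := leP x (M ^+ n) => /=; rewrite ?mulr0 ?mulr1 ?lexx ?(ltW x0).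
split => //; elim: N => [|N ih]; first by rewrite mulr0 (Er_ge0 beta01 w_stable).
have MN1 : 1 <= M ^+ N by apply: exprn_ege1; lra.
have MN0 : 0 <= M ^+ N by lra.
have bi := bmeas_itv `](M ^+ N), (M * M ^+ N)].
have pw x : 0 < x ->
    0 + (1 * (x * \1_`](1 : R), (M ^+ N)] x) + M ^+ N * \1_`](M ^+ N), (M * M ^+ N)] x)
    <= 0 + (1 * (x * \1_`](1 : R), (M ^+ N.+1)] x) + 0 * (x * \1_`](1 : R), (M ^+ N.+1)] x)).
  move=> x0; rewrite mul0r addr0 !add0r !mul1r !indic_itvE !in_itv/= exprS.
  have [xN|xN] := leP x (M ^+ N); rewrite ?andbT ?andbF /=.
    rewrite mulr0 addr0 (_ : x <= M * M ^+ N) ?andbT//; nra.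
  rewrite mulr0 add0r (_ : 1 < x)/=; last by lra.
  by have [xM|xM] := leP x (M * M ^+ N) => /=; lra.
have := Er_lin beta01 w_stable (bm N) bi (bm N.+1) (bm N.+1)
  (lexx 0) ler01 MN0 (lexx 0) ler01 (lexx 0) pw.
rewrite mul0r addr0 !add0r !mul1r => h; apply: (le_trans _ h).
rewrite -natr1 mulrDr mulr1 lerD//.
have := ler_wpM2l MN0 (hb _ MN1); apply: le_trans.
by rewrite mulrC divfK// gt_eqF//; lra.
Qed.

(** What remains of [Fsmall] after removing the time factor [t^(-d beta/2)] common to all
    dimensions; see [FsmallE]. *)
Definition Fscale (d : nat) Om : \bar R :=
  if d == 1%N then 1%E
  else if Om == 0 then +oo%E
  else if d == 2%N then (`|ln Om| + 1)%:E
  else (Om `^ (1 - d%:R / 2))%:E.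

(** The geometric sum of ratio [2^(p-1)], [p = d/2], is cut where [2^N] is comparable to [1/Om]. It
    is bounded for [d = 1], has [N] equal terms, of order [|ln Om| + 1], for [d = 2], and is
    governed by its last term, of order [Om^(1-p)], for [d >= 3]. *)
Lemma Ex_gker_small_le (d : nat) K : (1 <= d)%N -> 0 < K -> exists2 C : R, 0 < C &
  forall Om, 0 <= Om <= 1 -> (Ex (gker (d%:R / 2) (K * Om)) <= C%:E * Fscale d Om)%E.
Proof.
move=> d1 K0; pose p : R := d%:R / 2; rewrite /Fscale -/p.
have p0 : 0 < p by rewrite divr_gt0// ltr0n.
have [d_1|d_n1] := eqVneq d 1%N.
  have [|C C0 h] := Ex_gker_le_cst p0; first by rewrite /p d_1; lra.
  exists C => // Om /andP[Om0 _]; rewrite mule1; apply: h.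
  by rewrite mulr_ge0// ltW.
pose rho : R := 2 `^ (p - 1).
have pK0 : 0 < (p / K) `^ p by rewrite powR_gt0// divr_gt0.
have t0 : 0 < 2 `^ p :> R by rewrite powR_gt0.
(* Since [1/Om < 2^N], the remainder [(p/(K Om))^p (2/2^N)] is at most a constant times
   [Om^(1-p)]. *)
have step Om : 0 < Om -> Om <= 1 -> exists N : nat, [/\ Om^-1 < 2 ^+ N, 2 ^+ N <= 2 / Om &
    (Ex (gker p (K * Om)) <=
     (1 + 2 * 2 `^ p * \sum_(n < N) rho ^+ n + 2 * (p / K) `^ p * Om `^ (1 - p))%:E)%E].
  move=> Om0 Om1; have z1 : 1 <= Om^-1 by rewrite invf_ge1.
  have [N /andP[N1 N2]] := exists_expr (lexx 2) z1.
  exists N.+1; split => //; first by rewrite exprS ler_pM2l.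
  apply: (le_trans (Ex_gker_le_tpow N.+1 p0 (mulr_gt0 K0 Om0))).
  rewrite lee_fin lerD2l.
  have OV0 : 0 <= Om^-1 by lra.
  have -> : p / (K * Om) = p / K * Om^-1 by rewrite invfM mulrA.
  rewrite (powRM _ _ OV0) ?(ltW (divr_gt0 p0 K0))//.
  rewrite -[Om^-1](powR_inv1 (ltW Om0)) -powRrM mulN1r.
  rewrite powRD; last by rewrite (gt_eqF Om0) implybT.
  rewrite (powRr1 (ltW Om0)).
  have : 2 / 2 ^+ N.+1 <= 2 * Om.
    rewrite ler_pM2l// -[leRHS]invrK lef_pV2 ?posrE ?invr_gt0 ?exprn_gt0//.
    exact: ltW.
  have q0 : 0 <= (p / K) `^ p * Om `^ (- p) by rewrite mulr_ge0 ?powR_ge0.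
  by move=> /(ler_wpM2l q0); lra.
have [d_2|d_n2] := eqVneq d 2%N.
  have p1 : p = 1 by rewrite /p d_2 divff.
  have l2 : 0 < ln 2 :> R by rewrite ln_gt0// ltr1n.
  exists (1 + 4 * (1 + (ln 2)^-1) + 2 * (p / K) `^ p).
    have : 0 < (ln 2 : R)^-1 by rewrite invr_gt0.
    by lra.
  (* At [Om = 0] the right-hand side is [+oo]. *)
  move=> Om /andP[]; rewrite le_eqVlt => /predU1P[<-|Om0] Om1.
    rewrite eqxx gt0_muley ?leey// lte_fin.
    have : 0 < (ln 2 : R)^-1 by rewrite invr_gt0.
    by lra.
  rewrite (gt_eqF Om0); have [N [N1 N2 h]] := step Om Om0 Om1.
  apply: (le_trans h); rewrite -EFinM lee_fin.
  rewrite /rho p1 subrr !powRr0 powRr1//.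
  under eq_bigr do rewrite expr1n.
  rewrite sumr_const card_ord -mulr_natr mul1r !mulr1.
  rewrite ler0_norm ?ln_le0//.
  have lO : 0 <= - ln Om by rewrite oppr_ge0 ln_le0.
  have NE : N%:R * ln 2 <= ln 2 - ln Om.
    rewrite mulr_natl -lnXn// -ln_div ?posrE//.
    by rewrite ler_ln ?posrE ?exprn_gt0// divr_gt0.
  have {NE} : N%:R <= 1 + (ln 2)^-1 * (- ln Om).
    by rewrite -(ler_pM2r l2) mulrDl mulrAC mulVf ?gt_eqF//; lra.
  have : 0 < (ln 2 : R)^-1 by rewrite invr_gt0.
  move: (ln 2)^-1 (- ln Om) lO ((1 / K) `^ 1) (powR_ge0 (1 / K) 1) (N%:R).
  move=> r l l0 q q0 n r0 nl.
  by have := mulr_ge0 q0 l0; have := mulr_ge0 (ltW r0) l0; lra.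
have p1 : 1 < p.
  have : (3 <= d)%N by move: d1 d_n1 d_n2; case: d {p p0 rho pK0 t0 step} => [|[|[]]].
  by rewrite -(ler_nat R) /p; lra.
have rho1 : 1 < rho.
  by rewrite -[ltLHS](powRr0 2); apply: gt1_ltr_powR; lra.
exists (1 + 2 * 2 `^ p * ((rho - 1)^-1 * rho) + 2 * (p / K) `^ p).
  have : 0 < (rho - 1)^-1 * rho by rewrite mulr_gt0 ?invr_gt0; lra.
  nra.
move=> Om /andP[]; rewrite le_eqVlt => /predU1P[<-|Om0] Om1.
  rewrite eqxx gt0_muley ?leey// lte_fin.
  have : 0 < (rho - 1)^-1 * rho by rewrite mulr_gt0 ?invr_gt0; lra.
  nra.
rewrite (gt_eqF Om0); have [N [N1 N2 h]] := step Om Om0 Om1.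
apply: (le_trans h); rewrite -EFinM lee_fin.
have OE : Om `^ (1 - p) = Om^-1 `^ (p - 1).
  by rewrite -[Om^-1](powR_inv1 (ltW Om0)) -powRrM; congr (_ `^ _); lra.
have O1 : 1 <= Om `^ (1 - p).
  by rewrite OE; apply: powR_ge1; [rewrite invf_ge1|lra].
(* Now [rho > 1]: the sum is at most [rho^N / (rho - 1)], and [2^N <= 2/Om] gives
   [rho^N <= rho Om^(1-p)]. *)
have S : \sum_(n < N) rho ^+ n <= (rho - 1)^-1 * rho * Om `^ (1 - p).
  have -> : \sum_(n < N) rho ^+ n = (rho - 1)^-1 * (rho ^+ N - 1).
    by rewrite subrX1 mulKf// gt_eqF//; lra.
  rewrite -mulrA ler_wpM2l ?invr_ge0; first by [].
    lra.
  apply: (@le_trans _ _ (rho ^+ N)); first by lra.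
  rewrite /rho -powR_expr// OE -powRM ?invr_ge0 ?(ltW Om0)//.
  by apply: ge0_ler_powR; rewrite ?nnegrE ?divr_ge0 ?exprn_ge0 ?(ltW Om0)//; lra.
have := ler_wpM2l (ltW t0) S; move: O1; rewrite -/p.
move: (\sum_(n < N) _) (Om `^ _) => s O; lra.
Qed.

(** For [d = 2] the blocks up to [1/Om] are counted, each worth a constant. For [d >= 3] the single
    block from [1/Om] to [M/Om] suffices: the kernel there is of order [Om^(-p)] and the probability
    at least [kap Om]. *)
Lemma Ex_gker_small_ge (d : nat) K : (1 <= d)%N -> 0 < K -> exists2 C : R, 0 < C &
  forall Om, 0 <= Om <= 1 -> (C%:E * Fscale d Om <= Ex (gker (d%:R / 2) (K * Om)))%E.
Proof.
move=> d1 K0; pose p : R := d%:R / 2; rewrite /Fscale -/p.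
have p0 : 0 < p by rewrite divr_gt0// ltr0n.
have [c0 c00 hc0] := Ex_gker_ge_cst p0 K0.
have [d_1|d_n1] := eqVneq d 1%N.
  by exists c0 => // Om Om01; rewrite mule1; exact: hc0.
have p1 : 1 <= p.
  have : (2 <= d)%N by move: d1 d_n1; case: d {p p0 hc0} => [|[]].
  by rewrite -(ler_nat R) /p; lra.
have [kap [M [kap0 M2 hb]]] := tail_block beta01 w_stable.
(* Covers [Om = 0], where [Fscale] is infinite for [d >= 2]: [x^p >= x] for [x > 1], and the
   truncated means exceed [kap N] for every [N]. *)
have inf : Ex (gker p 0) = +oo%E.
  apply/eqyP => A _; pose N := Num.bound (`|A| / kap).
  have [bN hN] := Er_lin_block_ge N kap0 M2 hb.
  apply: (@le_trans _ _ (kap * N%:R)%:E).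
    rewrite lee_fin (le_trans (ler_norm A))// mulrC -ler_pdivrMr//.
    by apply/ltW/archi_boundP; rewrite divr_ge0// ltW.
  apply: (@le_trans _ _ (Er (fun x => x * \1_`](1 : R), (M ^+ N)] x))%:E).
    by rewrite lee_fin.
  apply: (Ex_ge_bmeas beta01 w_stable (mk p 0) bN) => x x0.
  rewrite /gker mul0r oppr0 expR0 mulr1 indic_itvE in_itv/=.
  have [x1|x1] := ltP 1 x; last by rewrite mulr0 powR_ge0.
  apply: (le_trans _ (le1r_powR (ltW x1) p1)); rewrite ler_piMr ?(ltW x0)//.
  by case: (x <= _).
have [d_2|d_n2] := eqVneq d 2%N.
  have p1' : p = 1 by rewrite /p d_2 divff.
  pose e := expR (- K) * kap; have e0 : 0 < e by rewrite mulr_gt0 ?expR_gt0.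
  have lM : 0 < ln M by rewrite ln_gt0//; lra.
  (* Makes [c1 ((N+1) ln M + 1)] at most the average of the two lower bounds [e N] and [c0]. The
     bound [c0] takes over when [N = 0]. *)
  pose c1 := Num.min (e / (2 * ln M)) (c0 / (2 * (ln M + 1))).
  have c10 : 0 < c1 by rewrite lt_min !divr_gt0// mulr_gt0//; lra.
  exists c1 => // Om /andP[]; rewrite le_eqVlt => /predU1P[<-|Om0] Om1.
    by rewrite mulr0 inf leey.
  rewrite (gt_eqF Om0).
  have z1 : 1 <= Om^-1 by rewrite invf_ge1.
  have [N /andP[N1 N2]] := exists_expr M2 z1.
  have [bN hN] := Er_lin_block_ge N kap0 M2 hb.
  (* Up to [M^N <= 1/Om] the exponential factor stays above [exp(-K)]. *)
  have hE : ((e * N%:R)%:E <= Ex (gker p (K * Om)))%E.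
    apply: (@le_trans _ _ (expR (- K) * Er (fun x => x * \1_`](1 : R), (M ^+ N)] x))%:E).
      by rewrite lee_fin /e -mulrA ler_wpM2l ?expR_ge0.
    rewrite -(ErZ beta01 w_stable (expR_ge0 _) bN).
    apply: (Ex_ge_bmeas beta01 w_stable (mk p _) (bmeasZ (expR_ge0 _) bN)) => x x0.
    rewrite /gker p1' (powRr1 (ltW x0)) indic_itvE in_itv/=.
    have [x1|x1] := ltP 1 x => /=.
      have [xM|xM] := leP x (M ^+ N) => /=.
        rewrite mulr1 mulrC ler_wpM2l ?(ltW x0)// ler_expR lerN2 -mulrA ler_piMr ?(ltW K0)//.
        rewrite -(mulfV (lt0r_neq0 Om0)) ler_wpM2l ?(ltW Om0)//.
        exact: le_trans N1.
      by rewrite !mulr0 mulr_ge0 ?expR_ge0 ?(ltW x0).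
    by rewrite !mulr0 mulr_ge0 ?expR_ge0 ?(ltW x0).
  have hc := hc0 Om; rewrite (ltW Om0) Om1 in hc; have {}hc := hc isT.
  have : ((Num.max c0 (e * N%:R))%:E <= Ex (gker p (K * Om)))%E.
    by rewrite EFin_max ge_max hc.
  apply: le_trans; rewrite -EFinM lee_fin.
  rewrite ler0_norm ?ln_le0//.
  have NE : - ln Om <= (N%:R + 1) * ln M.
    rewrite -lnV ?posrE// natr1 mulr_natl -lnXn; last by lra.
    by rewrite ler_ln ?posrE ?exprn_gt0 ?invr_gt0 ?(ltW N2)//; lra.
  have h1 : c1 * (2 * ln M) <= e.
    by rewrite -ler_pdivlMr ?mulr_gt0// /c1 ge_min lexx.
  have h2 : c1 * (2 * (ln M + 1)) <= c0.
    by rewrite -ler_pdivlMr ?mulr_gt0 ?ltr_wpDl// ?(ltW lM)// /c1 ge_min lexx orbT.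
  apply: (@le_trans _ _ (c1 * ((N%:R + 1) * ln M + 1))).
    by rewrite ler_wpM2l ?(ltW c10)// lerD2r.
  have N0 : 0 <= N%:R :> R by [].
  have := ler_wpM2l N0 h1.
  rewrite le_max; have [//|le2] := leP (c1 * ((N%:R + 1) * ln M + 1)) c0.
  by move=> ?; rewrite /=; lra.
exists (expR (- (K * M)) * kap); first by rewrite mulr_gt0 ?expR_gt0.
move=> Om /andP[]; rewrite le_eqVlt => /predU1P[<-|Om0] Om1.
  by rewrite mulr0 inf leey.
rewrite (gt_eqF Om0).
have OV0 : 0 < Om^-1 by rewrite invr_gt0.
have z1 : 1 <= Om^-1 by rewrite invf_ge1.
have k0 : 0 <= Om `^ (- p) * expR (- (K * M)) by rewrite mulr_ge0 ?powR_ge0 ?expR_ge0.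
have h x : 0 < x -> x \in `]Om^-1, (M * Om^-1)] ->
    Om `^ (- p) * expR (- (K * M)) <= gker p (K * Om) x.
  move=> x0; rewrite in_itv/= => /andP[yx xy].
  have -> : Om `^ (- p) = Om^-1 `^ p.
    by rewrite -(powR_inv1 (ltW Om0)) -powRrM mulN1r.
  rewrite ler_pM ?powR_ge0 ?expR_ge0//.
    by apply: ge0_ler_powR; rewrite ?nnegrE ?(ltW p0) ?(ltW x0) ?(ltW yx) ?(ltW OV0).
  rewrite ler_expR lerN2 -mulrA ler_wpM2l ?(ltW K0)//.
  by rewrite mulrC -ler_pdivlMr.
apply: le_trans (Ex_gker_ge_itv k0 h).
rewrite -EFinM lee_fin.
have := ler_wpM2l k0 (hb _ z1); apply: le_trans.
rewrite invrK powRD; last by rewrite (gt_eqF Om0) implybT.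
by rewrite (powRr1 (ltW Om0)); lra.
Qed.

End stable_moments.

(** * Image of a measure with density *)

Section density_pushforward.
Local Open Scope ereal_scope.
Context d d' (T : measurableType d) (T' : measurableType d') (R : realType).
Variables (mu : {measure set T -> \bar R}) (phi : T -> T') (D : set T) (rho : T -> R).
Hypotheses (mphi : measurable_fun setT phi) (mD : measurable D).
Hypotheses (mrho : measurable_fun D rho) (rho0 : forall x, D x -> (0 <= rho x)%R).

(** Treating the image of [rho dmu] as a measure reduces a change of variables to the equality of
    two measures. *)
Definition density_image (A : set T') : \bar R :=
  \int[mu]_(x in phi @^-1` A `&` D) (rho x)%:E.

Let mpre A : measurable A -> measurable (phi @^-1` A `&` D).
Proof. by move=> mA; apply: measurableI => //; rewrite -[X in measurable X]setTI; exact: mphi. Qed.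

Let density_image0 : density_image set0 = 0.
Proof. by rewrite /density_image preimage_set0 set0I integral_set0. Qed.

Let density_image_ge0 A : 0 <= density_image A.
Proof. by apply: integral_ge0 => x [_ Dx]; rewrite lee_fin rho0. Qed.

Let density_image_sigma_additive : semi_sigma_additive density_image.
Proof.
move=> F mF tF mUF; rewrite /density_image preimage_bigcup setI_bigcupl.
have mF' n := mpre (mF n).
rewrite ge0_integral_bigcup//=.
- by apply: is_cvg_ereal_nneg_natsum => n _; exact: density_image_ge0.
- apply/measurable_EFinP; apply: measurable_funS mrho => //.
  by move=> x [n _ [_ Dx]].
- by move=> x [n _ [_ Dx]]; rewrite lee_fin rho0.
- apply/trivIsetP => /= i j _ _ ij; rewrite setIACA setIid -preimage_setI.
  by move/trivIsetP : tF => /(_ _ _ _ _ ij) ->//; rewrite preimage_set0 set0I.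
Qed.

HB.instance Definition _ := isMeasure.Build _ _ _
  density_image density_image0 density_image_ge0 density_image_sigma_additive.

Definition density_measure : {measure set T' -> \bar R} := density_image.

Import HBNNSimple.

(** Holds by definition for indicators, then for simple functions by linearity, then for [f] by
    monotone convergence on both sides. *)
Lemma ge0_integral_density_image (E : set T') (f : T' -> \bar R) :
  measurable E -> measurable_fun E f -> (forall y, E y -> 0 <= f y) ->
  \int[density_measure]_(y in E) f y =
  \int[mu]_(x in phi @^-1` E `&` D) (f (phi x) * (rho x)%:E).
Proof.
move=> mE mf f0; rewrite /density_measure; pose f_ := nnsfun_approx mE mf; have mpE := mpre mE.
have mrho' : measurable_fun (phi @^-1` E `&` D) rho.
  by apply: measurable_funS mrho => // x [].
have mi n : measurable_fun (phi @^-1` E `&` D) (fun x => f_ n (phi x)).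
  by apply: measurable_funTS; exact: measurableT_comp.
transitivity (limn (fun n => \int[density_image]_(y in E) (f_ n y)%:E)).
  rewrite -monotone_convergence//.
  - apply: eq_integral => y /[!inE] yE; apply/esym/cvg_lim => //.
    exact: cvg_nnsfun_approx.
  - by move=> n; exact/measurable_EFinP/measurable_funTS.
  - by move=> n y _; rewrite lee_fin.
  - by move=> y _ m n mn; rewrite lee_fin; exact/lefP/nd_nnsfun_approx.
transitivity (limn (fun n =>
  \int[mu]_(x in phi @^-1` E `&` D) ((f_ n (phi x))%:E * (rho x)%:E))); last first.
  rewrite -monotone_convergence//; last 3 first.
  - by move=> n; apply/measurable_EFinP; exact: measurable_funM.
  - by move=> n x [_ Dx]; rewrite mule_ge0// lee_fin// rho0.
  - move=> x [_ Dx] m n mn; rewrite lee_wpmul2r// ?lee_fin ?rho0//.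
    exact/lefP/nd_nnsfun_approx.
  apply: eq_integral => x /[!inE] -[Ephix Dx]; apply/cvg_lim => //.
  apply: cvgeZr => //; apply: cvg_nnsfun_approx => //.
congr (limn _); apply/funext => n.
have mpk r : measurable (f_ n @^-1` [set r]) by [].
(* For one simple function both sides equal the sum over its values of the value times the mass of
   its level set. *)
transitivity (\sum_(k \in range (f_ n)) k%:E * density_image (f_ n @^-1` [set k] `&` E)).
  under eq_integral do rewrite fimfunE -fsumEFin//.
  rewrite ge0_integral_fsum//; last 2 first.
  - by move=> r; apply/measurable_EFinP/measurable_funTS/measurable_funM.
  - by move=> r y _; rewrite nnfun_muleindic_ge0.
  apply: eq_fsbigr => r _.
  by rewrite integralZl_indic_nnsfun// integral_indic.
transitivity (\int[mu]_(x in phi @^-1` E `&` D)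
   \sum_(k \in range (f_ n)) ((k * \1_(f_ n @^-1` [set k]) (phi x))%:E * (rho x)%:E)); last first.
  apply: eq_integral => x _; rewrite fimfunE -fsumEFin// ge0_mule_fsuml// => k.
  by rewrite nnfun_muleindic_ge0.
rewrite ge0_integral_fsum//; last 2 first.
- move=> r; apply/measurable_EFinP/measurable_funM => //.
  apply: measurable_funM => //; apply: measurable_funTS.
  by apply: (measurableT_comp _ mphi).
- by move=> r x [_ Dx]; rewrite mule_ge0 ?nnfun_muleindic_ge0// lee_fin rho0.
apply: eq_fsbigr => r /[!inE] -[z _ zr].
have r0 : (0 <= r)%R by rewrite -zr.
under eq_integral do rewrite EFinM -muleA.
rewrite ge0_integralZl_EFin//; last 2 first.
- by move=> x [_ Dx]; rewrite mule_ge0// lee_fin// rho0.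
- apply/measurable_EFinP/measurable_funM => //.
  by apply: measurable_funTS; apply: measurableT_comp.
congr (_ * _); rewrite /density_image.
rewrite preimage_setI -setIA integral_mkcondl.
apply: eq_integral => x _; rewrite /patch indicE.
have -> : (phi x \in f_ n @^-1` [set r]) = (x \in phi @^-1` (f_ n @^-1` [set r])).
  by apply/idP/idP; rewrite !inE.
by case: ifPn => _; rewrite ?mul1e ?mul0e.
Qed.

End density_pushforward.

(** * The substitution [u = z^(-b)] on the half-line *)

Section power_substitution.
Import numFieldNormedType.Exports.
Context (R : realType) (b : R).
Hypothesis b0 : 0 < b.
Local Notation leb := (@lebesgue_measure R).
Local Notation pos := (`]0%R, +oo[%classic : set R).

(** The Jacobian [|du/dz|] of [u = z^(-b)]. *)
Definition inv_density (z : R) : R := b * z `^ (-1 - b).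

Lemma powRNV (x : R) : 0 < x -> (x `^ (- b^-1)) `^ (- b) = x.
Proof.
by move=> x0; rewrite -powRrM mulrNN mulVf ?gt_eqF// powRr1 ?ltW.
Qed.

Lemma powRN_lt (x y : R) : 0 < x -> 0 < y -> (x `^ (- b) < y `^ (- b)) = (y < x).
Proof.
move=> x0 y0; rewrite !powRN ltf_pV2 ?posrE ?powR_gt0//.
have h u v : 0 < u -> 0 < v -> u < v -> u `^ b < v `^ b.
  by move=> u0 v0; apply: gt0_ltr_powR; rewrite ?nnegrE ?ltW.
apply/idP/idP => [|/h]; last exact.
by apply: contraTT; rewrite -!leNgt le_eqVlt => /predU1P[->//|/h/ltW]; exact.
Qed.

Lemma measurable_inv_density (D : set R) : measurable_fun D inv_density.
Proof.
by apply: measurable_funTS; apply: measurable_funM => //; exact: measurable_powR.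
Qed.

Lemma inv_density_ge0 z : 0 <= inv_density z.
Proof. by rewrite mulr_ge0 ?powR_ge0 ?ltW. Qed.

Lemma integral_inv_density (a : R) : 0 < a ->
  (\int[leb]_(z in `[a, +oo[) (inv_density z)%:E = (a `^ (- b))%:E)%E.
Proof.
move=> a0.
have dF (x : R) : 0 < x -> derivable (fun z : R => - (z `^ (- b))) x 1.
  by move=> x0; apply/derivableN/derivable_powR; rewrite in_itv/= x0.
have cF (x : R) : 0 < x -> continuous_at x (fun z : R => - (z `^ (- b))).
  by move=> x0; apply: differentiable_continuous; apply/derivable1_diffP; exact: dF.
rewrite (@ge0_continuous_FTC2y _ _ (fun z => - (z `^ (- b))) _ 0).
- by rewrite -EFinB sub0r opprK.
- by move=> x _; exact: inv_density_ge0.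
- apply: continuous_in_subspaceT => x; rewrite inE/= in_itv/= andbT => ax.
  apply: cvgM; first exact: cvg_cst.
  have x0 : 0 < x by lra.
  have : differentiable (fun z : R => z `^ (-1 - b)) x.
    by apply/derivable1_diffP; apply: derivable_powR; rewrite in_itv/= x0.
  exact: differentiable_continuous.
- rewrite -oppr0; apply: cvgN; apply/cvgrPdist_lt => e e0; near=> z.
  have z0 : 0 < z by near: z; exact: nbhs_pinfty_gt.
  have ze : e `^ (- b^-1) < z by near: z; exact: nbhs_pinfty_gt.
  by rewrite sub0r normrN ger0_norm ?powR_ge0// -(powRNV e0) powRN_lt ?powR_gt0.
- by move=> x ax; apply: dF; lra.
- by apply: cvg_at_right_filter; exact: cF.
- move=> x; rewrite in_itv/= andbT => ax; have x0 : 0 < x by lra.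
  rewrite derive1N; last by apply: derivable_powR; rewrite in_itv/= x0.
  rewrite /= powR_derive1 ?in_itv/= ?x0//.
  by rewrite mulNr opprK /inv_density; congr (_ * _ `^ _); lra.
Unshelve. all: by end_near. Qed.

Lemma measurable_powRN : measurable_fun setT (fun z : R => z `^ (- b)).
Proof. exact: measurable_powR. Qed.

Let mpos : measurable pos. Proof. exact: measurable_itv. Qed.

Definition inv_measure : {measure set (measurableTypeR R) -> \bar R} :=
  @density_measure _ _ _ (measurableTypeR R) _ leb _ _ _ measurable_powRN mpos
    (@measurable_inv_density pos)
    (fun x _ => inv_density_ge0 x).

(** Lebesgue measure restricted to the half-line and [inv_measure] both give []-oo, x[] the value
    [max(x, 0)]. These rays are stable under intersection and generate the Borel sets, so the
    measures coincide. *)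
Lemma lebesgue_inv_measure (A : set R) : measurable A -> A `<=` pos ->
  leb A = inv_measure A.
Proof.
move=> mA Apos; have -> : leb A = mrestr leb mpos A by rewrite /mrestr setIidl.
pose g (k : nat) : set R := `]-oo, k%:R[%classic.
have cap_le0 (x : R) (B : set R) : x <= 0 -> (forall y, B y -> y < x) -> B `&` pos = set0.
  move=> x0 Bx; rewrite -subset0 => y [/Bx yx]; rewrite /= in_itv/= andbT; lra.
have m1E (x : R) : mrestr leb mpos `]-oo, x[%classic = (Num.max x 0)%:E.
  rewrite /mrestr; have [x0|x0] := leP x 0.
    by rewrite (cap_le0 _ _ x0) ?measure0// => y; rewrite /= in_itv.
  rewrite (_ : _ `&` _ = `]0%R, x[%classic); last first.
    apply/seteqP; split => y /=; rewrite !in_itv/= andbT.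
      by move=> [-> ->].
    by move=> /andP[-> ->].
  by rewrite lebesgue_measure_itv/= lte_fin x0 oppr0 adde0.
have m2E (x : R) : inv_measure `]-oo, x[%classic = (Num.max x 0)%:E.
  pose B : set R := (fun z : R => z `^ (- b)) @^-1` `]-oo, x[ `&` pos.
  rewrite -[LHS]/(\int[leb]_(z in B) (inv_density z)%:E)%E; have [x0|x0] := leP x 0.
    rewrite (_ : B = set0) ?integral_set0//.
    rewrite -subset0 => y []; rewrite /= !in_itv/= => h _.
    by have := powR_ge0 y (- b); lra.
  rewrite (_ : B = `](x `^ (- b^-1)), +oo[%classic); last first.
    have xb0 : 0 < x `^ (- b^-1) by rewrite powR_gt0.
    have E y : 0 < y -> (y `^ (- b) < x) = (x `^ (- b^-1) < y).
      by move=> y0; rewrite -[in LHS](powRNV x0) powRN_lt.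
    apply/seteqP; split => y; rewrite /B /= !in_itv/= !andbT.
      by move=> [+ y0]; rewrite E.
    by move=> yx; have y0 : 0 < y := lt_trans xb0 yx; rewrite E // yx y0.
  rewrite integral_itv_obnd_cbnd; last first.
    by apply/measurable_EFinP; exact: measurable_inv_density.
  by rewrite integral_inv_density ?powR_gt0// powRNV.
pose m1 : {measure set (measurableTypeR R) -> \bar R} := mrestr leb mpos.
pose m2 : {measure set (measurableTypeR R) -> \bar R} := inv_measure.
have h : m1 A = m2 A; last exact: h.
apply: (@measure_unique _ R (measurableTypeR R) (@RGenInftyO.G R) g _ _ _ _ m1 m2).
- exact: RGenInftyO.measurableE.
- move=> _ _ [x ->] [y ->]; exists (Num.min x y).
  by apply/seteqP; split => z /=; rewrite !in_itv/= lt_min => /andP.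
- by move=> k; exists k%:R.
- rewrite -subTset => x _; exists (Num.bound `|x : R|) => //.
  rewrite /g /= in_itv/=.
  by rewrite (le_lt_trans (ler_norm (x : R)))// archi_boundP.
- by move=> _ [x ->]; rewrite [LHS]m1E [RHS]m2E.
- by move=> k; rewrite [ltLHS]m1E ltry.
- exact: mA.
Qed.

Lemma ge0_integral_powN (f : R -> \bar R) : measurable_fun pos f ->
  (forall x, pos x -> 0 <= f x)%E ->
  (\int[leb]_(u in pos) f u =
   \int[leb]_(z in pos) (f (z `^ (- b))%R * (inv_density z)%:E))%E.
Proof.
move=> mf f0.
transitivity (\int[inv_measure]_(u in pos) f u)%E.
  by apply: eq_measure_integral => A mA Apos; exact: lebesgue_inv_measure.
rewrite /inv_measure ge0_integral_density_image//.
congr (integral _ _ _); apply/seteqP; split => [x []//|x x0]; split => //=.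
by rewrite in_itv/= powR_gt0//; move: x0; rewrite /= in_itv/= andbT.
Qed.

End power_substitution.

(** * From Aronson's bounds to expectations of the kernel *)

Section subordination.
Context (R : realType) (d : nat) (beta : R) (w : R -> R)
  (G : R -> 'rV[R]_d -> 'rV[R]_d -> R).
Hypothesis beta01 : 0 < beta < 1.
Hypothesis w_stable : is_stable_density beta w.
Hypothesis mG : forall x y,
  measurable_fun (`]0%R, +oo[%classic : set R) (fun s => G s x y).
Local Notation leb := (@lebesgue_measure R).
Local Notation pos := (`]0%R, +oo[%classic : set R).

Let beta0 : 0 < beta. Proof. by case/andP: beta01. Qed.
Let b0 : 0 < beta^-1. Proof. by rewrite invr_gt0. Qed.

(** The density of [1/X = S^(-beta)], so that [Gbeta] is a mixture of the values of [G] at times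
    [t^beta z]; the prefactor [1/beta] is part of it. *)
Definition mixing_density (z : R) : R := w (z `^ (- beta^-1)) * inv_density beta^-1 z.

Lemma mixing_density_ge0 z : 0 < z -> 0 <= mixing_density z.
Proof.
by move=> z0; rewrite mulr_ge0 ?inv_density_ge0// (w_ge0 w_stable)// powR_gt0.
Qed.

Lemma measurable_mixing_density : measurable_fun pos mixing_density.
Proof.
apply: measurable_funM; last exact: measurable_inv_density.
have [_ [mw _]] := w_stable.
apply: (measurable_comp _ _ mw) => //=.
- by move=> _ [z /= z0 <-]; rewrite in_itv/= andbT powR_gt0//; move: z0; rewrite in_itv/= andbT.
- by apply: measurable_funTS; exact: measurable_powRN.
Qed.

Lemma measurable_G_scaled (k : R) x y : 0 < k ->
  measurable_fun pos (fun z => G (k * z) x y).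
Proof.
move=> k0; apply: (measurable_comp _ _ (mG x y)) => //=.
by move=> _ [z /= + <-]; rewrite !in_itv/= !andbT => z0; rewrite mulr_gt0.
Qed.

Lemma GbetaE t x y : 0 < t -> (forall s, 0 < s -> 0 <= G s x y) ->
  Gbeta beta w G t x y =
  (\int[leb]_(z in pos) (G (t `^ beta * z) x y * mixing_density z)%:E)%E.
Proof.
move=> t0 G0; have tb0 : 0 < t `^ beta by rewrite powR_gt0.
have mw : measurable_fun pos (fun z => beta * (G (t `^ beta * z) x y * mixing_density z)).
  apply: measurable_funM => //; apply: measurable_funM; first exact: measurable_G_scaled.
  exact: measurable_mixing_density.
have mE z : 0 < z -> G (t `^ beta * z) x y * z `^ (-1 - beta^-1) * w (z `^ (- beta^-1)) =
    beta * (G (t `^ beta * z) x y * mixing_density z).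
  by move=> z0; rewrite /mixing_density /inv_density; field; rewrite gt_eqF.
rewrite /Gbeta.
rewrite (@eq_integral _ _ _ leb pos
  (fun z => (beta * (G (t `^ beta * z) x y * mixing_density z))%:E)); last first.
  by move=> z; rewrite inE/= in_itv/= andbT => /mE ->.
rewrite -ge0_integralZl//.
- by apply: eq_integral => z _; rewrite -EFinM mulKf// gt_eqF.
- exact/measurable_EFinP.
- move=> z; rewrite /= in_itv/= andbT => z0; rewrite lee_fin mulr_ge0 ?(ltW beta0)//.
  by rewrite mulr_ge0 ?mixing_density_ge0// G0// mulr_gt0.
- by rewrite lee_fin ltW.
Qed.

(** Under [u = z^(-1/beta)] the variable [u^beta] becomes [1/z]. *)
Lemma Ex_gkerE p a : Ex beta w (gker p a) =
  (\int[leb]_(z in pos) (gker p a z^-1 * mixing_density z)%:E)%E.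
Proof.
rewrite /Ex (ge0_integral_powN b0).
- apply: eq_integral => z; rewrite inE/= in_itv/= andbT => z0.
  rewrite -EFinM -powRrM mulNr mulVf ?gt_eqF// powR_inv1 ?(ltW z0)//.
  by rewrite -mulrA.
- exact: (Ex_meas w_stable (@measurable_gker R p a)).
- by apply: (Ex_integrand_ge0 w_stable) => x _; exact: gker_ge0.
Qed.

(** At time [s = t^beta z] the quotient [|x-y|^2 / s] is [Omega / z], and [s^(-d/2)] splits into a
    power of [t] and [(1/z)^(d/2)]. *)
Lemma heat_kernelE K t (x y : 'rV[R]_d) z : 0 < t -> 0 < z ->
  (t `^ beta * z) `^ (- (d%:R / 2)) * expR (- (K * sqdist x y / (t `^ beta * z))) =
  t `^ (- (d%:R * beta / 2)) * gker (d%:R / 2) (K * Omega beta t x y) z^-1.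
Proof.
move=> t0 z0; have tb0 : 0 < t `^ beta by rewrite powR_gt0.
rewrite (powRM _ (ltW tb0) (ltW z0)) /gker -!mulrA.
congr (_ * (_ * expR (- _))).
- by rewrite -powRrM; congr (_ `^ _); field.
- by rewrite -[z^-1](powR_inv1 (ltW z0)) -powRrM mulN1r.
- by rewrite /Omega powRN; field; rewrite !gt_eqF.
Qed.

Lemma measurable_gker_inv p a : measurable_fun pos (fun z => gker p a z^-1).
Proof.
apply: (@eq_measurable_fun _ _ _ _ _ (fun z => gker p a (z `^ (-1)))).
  by move=> z; rewrite inE/= in_itv/= andbT => z0; rewrite powR_inv1// ltW.
apply: measurable_funTS; apply: measurableT_comp; first exact: measurable_gker.
exact: measurable_powR.
Qed.

Lemma integral_gkerZ k p a : 0 <= k ->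
  ((k%:E * Ex beta w (gker p a)) =
  \int[leb]_(z in pos) (k * gker p a z^-1 * mixing_density z)%:E)%E.
Proof.
move=> k0; rewrite Ex_gkerE -ge0_integralZl//.
- by apply: eq_integral => z _; rewrite -EFinM mulrA.
- apply/measurable_EFinP; apply: measurable_funM; last exact: measurable_mixing_density.
  exact: measurable_gker_inv.
- move=> z; rewrite /= in_itv/= andbT => z0.
  by rewrite lee_fin mulr_ge0 ?gker_ge0// mixing_density_ge0.
Qed.

Lemma Gbeta_bounds c c' C C' t x y : 0 < c -> 0 < C -> aronson_bounds G c c' C C' -> 0 < t ->
  let T := t `^ (- (d%:R * beta / 2)) in
  ((c * T)%:E * Ex beta w (gker (d%:R / 2) (c' * Omega beta t x y))
     <= Gbeta beta w G t x y /\
   Gbeta beta w G t x y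
     <= (C * T)%:E * Ex beta w (gker (d%:R / 2) (C' * Omega beta t x y)))%E.
Proof.
move=> c0 C0 hG t0 T; have tb0 : 0 < t `^ beta by rewrite powR_gt0.
have T0 : 0 < T by rewrite powR_gt0.
have G0 s : 0 < s -> 0 <= G s x y.
  move=> s0; have [+ _] := hG s x y s0; apply: le_trans.
  by rewrite !mulr_ge0 ?powR_ge0 ?expR_ge0 ?ltW.
have mGw : measurable_fun pos (fun z => G (t `^ beta * z) x y * mixing_density z).
  apply: measurable_funM; first exact: measurable_G_scaled.
  exact: measurable_mixing_density.
have mk k a : measurable_fun pos (fun z => k * gker (d%:R / 2) a z^-1 * mixing_density z).
  apply: measurable_funM; last exact: measurable_mixing_density.
  by apply: measurable_funM => //; exact: measurable_gker_inv.
have cT0 : 0 <= c * T by rewrite mulr_ge0 ?ltW.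
have CT0 : 0 <= C * T by rewrite mulr_ge0 ?ltW.
rewrite (GbetaE t0 G0) !integral_gkerZ//; split; apply: ge0_le_integral => //.
- move=> z; rewrite /= in_itv/= andbT => z0.
  by rewrite lee_fin mulr_ge0 ?mixing_density_ge0// mulr_ge0 ?gker_ge0.
- apply/measurable_EFinP; exact: mk.
- apply/measurable_EFinP; exact: mGw.
- move=> z; rewrite /= in_itv/= andbT => z0.
  have [+ _] := hG _ x y (mulr_gt0 tb0 z0).
  rewrite -mulrA heat_kernelE// lee_fin mulrA => h.
  by rewrite ler_wpM2r ?mixing_density_ge0.
- move=> z; rewrite /= in_itv/= andbT => z0.
  by rewrite lee_fin mulr_ge0 ?mixing_density_ge0// G0// mulr_gt0.
- apply/measurable_EFinP; exact: mGw.
- apply/measurable_EFinP; exact: mk.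
- move=> z; rewrite /= in_itv/= andbT => z0.
  have [_] := hG _ x y (mulr_gt0 tb0 z0).
  rewrite -mulrA heat_kernelE// lee_fin mulrA => h.
  by rewrite ler_wpM2r ?mixing_density_ge0.
Qed.

End subordination.

(** * Assembly of the two regimes *)

Lemma FsmallE (R : realType) (d : nat) (beta t Om : R) : 0 < t ->
  Fsmall d beta t Om = ((t `^ (- (d%:R * beta / 2)))%:E * Fscale d Om)%E.
Proof.
move=> t0; rewrite /Fsmall /Fscale.
have T0 : 0 < t `^ (- (d%:R * beta / 2)) by rewrite powR_gt0.
have [->|_] := eqVneq d 1%N; first by rewrite mule1 mul1r.
have [_|_] := eqVneq Om 0; first by rewrite gt0_muley.
have [->|_] := eqVneq d 2%N; last by rewrite EFinM.
by rewrite EFinM; congr ((_ `^ - _)%:E * _)%E; field.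
Qed.

Lemma Fscale_ge0 (R : realType) (d : nat) (Om : R) : (0 <= Fscale d Om)%E.
Proof.
rewrite /Fscale; case: ifP => // _; case: ifP => // _.
by case: ifP => _; rewrite lee_fin ?powR_ge0// addr_ge0.
Qed.

Theorem theorem1 (R : realType) (d : nat) (beta : R) (w : R -> R)
  (G : R -> 'rV[R]_d -> 'rV[R]_d -> R) (c c' C C' : R) :
  (1 <= d)%N -> 0 < beta < 1 ->
  is_stable_density beta w ->
  (forall x y : 'rV[R]_d, measurable_fun (`]0%R, +oo[%classic : set R) (fun s => G s x y)) ->
  0 < c -> 0 < c' -> 0 < C -> 0 < C' ->
  aronson_bounds G c c' C C' ->
  exists c1 C1 c2 C2 : R,
    [/\ 0 < c1, c1 <= C1, 0 < c2, 0 < C2 &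
    forall (t : R) (x y : 'rV[R]_d), 0 < t ->
      (Omega beta t x y <= 1 ->
         (c1%:E * Fsmall d beta t (Omega beta t x y) <= Gbeta beta w G t x y)%E /\
         (Gbeta beta w G t x y <= C1%:E * Fsmall d beta t (Omega beta t x y))%E) /\
      (1 <= Omega beta t x y ->
         ((c1 * t `^ (- (d%:R * beta / 2))
              * (Omega beta t x y) `^ (- (d%:R / 2 * ((1 - beta) / (2 - beta))))
              * expR (- (C2 * (Omega beta t x y) `^ ((2 - beta)^-1))))%:E
            <= Gbeta beta w G t x y)%E /\
         (Gbeta beta w G t x y <=
            (C1 * t `^ (- (d%:R * beta / 2))
              * (Omega beta t x y) `^ (- (d%:R / 2 * ((1 - beta) / (2 - beta))))
              * expR (- (c2 * (Omega beta t x y) `^ ((2 - beta)^-1))))%:E)%E)].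
Proof.
move=> d1 beta01 w_stable mG c0 c'0 C0 C'0 hG.
have p0 : 0 < d%:R / 2 :> R by rewrite divr_gt0// ltr0n.
have [Cs Cs0 hCs] := Ex_gker_small_le beta01 w_stable d1 C'0.
have [cs cs0 hcs] := Ex_gker_small_ge beta01 w_stable d1 c'0.
have [Cl [cl [Cl0 cl0 hCl]]] := Ex_gker_large_le beta01 w_stable p0 C'0.
have [Cg [cg [Cg0 cg0 hCg]]] := Ex_gker_large_ge beta01 w_stable p0 c'0.
pose c1 := Num.min (c * cs) (c * Cg).
pose C1 := Num.max c1 (Num.max (C * Cs) (C * Cl)).
have c10 : 0 < c1 by rewrite lt_min !mulr_gt0.
exists c1, C1, cl, cg; split => //; first by rewrite /C1 le_max lexx.
have c1s : c1 <= c * cs by rewrite /c1 ge_min lexx.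
have c1g : c1 <= c * Cg by rewrite /c1 ge_min lexx orbT.
have C1s : C * Cs <= C1 by rewrite /C1 !le_max lexx orbT.
have C1l : C * Cl <= C1 by rewrite /C1 !le_max lexx !orbT.
move=> t x y t0; have [] := Gbeta_bounds beta01 w_stable mG x y c0 C0 hG t0.
set T := t `^ _; set Om := Omega beta t x y => lo up.
have T0 : 0 < T by rewrite powR_gt0.
have Om0 : 0 <= Om.
  by rewrite mulr_ge0 ?powR_ge0// sumr_ge0// => i _; exact: sqr_ge0.
split=> Om1.
  have Om01 : 0 <= Om <= 1 by rewrite Om0.
  have F0 := Fscale_ge0 d Om.
  rewrite FsmallE// -/T; split.
    apply: le_trans lo.
    apply: (@le_trans _ _ ((c * T)%:E * (cs%:E * Fscale d Om))%E); last first.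
      by rewrite lee_wpmul2l ?hcs// lee_fin mulr_ge0 ?ltW.
    rewrite !muleA -!EFinM lee_wpmul2r// lee_fin mulrAC.
    by rewrite ler_wpM2r ?(ltW T0).
  apply: (le_trans up).
  apply: (@le_trans _ _ ((C * T)%:E * (Cs%:E * Fscale d Om))%E).
    by rewrite lee_wpmul2l ?hCs// lee_fin mulr_ge0 ?ltW.
  rewrite !muleA -!EFinM lee_wpmul2r// lee_fin mulrAC.
  by rewrite ler_wpM2r ?(ltW T0).
have [b0 b1] := andP beta01.
have Om_gt0 : 0 < Om by lra.
have b2 : 0 < 2 - beta by lra.
(* The solution of [L y0 = L^beta] and [Om y0 = L]: the first gives [y0 = L^(beta-1)], and then
   [Om = L^(2-beta)]. *)
pose L := Om `^ (2 - beta)^-1; pose y0 := Om `^ (- ((1 - beta) / (2 - beta))).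
have powE r s : Om `^ r * Om `^ s = Om `^ (r + s).
  by rewrite powRD// (gt_eqF Om_gt0) implybT.
have L1 : 1 <= L by apply: powR_ge1 => //; rewrite invr_ge0 ltW.
have y00 : 0 < y0 by rewrite powR_gt0.
have Ly : L * y0 = L `^ beta.
  by rewrite /L -powRrM powE; congr (_ `^ _); field; rewrite gt_eqF.
have Oy : Om * y0 = L.
  rewrite -[X in X * _](powRr1 Om0) powE; congr (_ `^ _); field.
  by rewrite gt_eqF.
(* The polynomial prefactor in (ii) is exactly [y0^(d/2)]. *)
have y0p : y0 `^ (d%:R / 2) = Om `^ (- (d%:R / 2 * ((1 - beta) / (2 - beta)))).
  by rewrite -powRrM; congr (_ `^ _); rewrite mulNr mulrC.
have {}hCl := hCl _ _ _ L1 y00 Ly Oy; have {}hCg := hCg _ _ _ L1 y00 Ly Oy.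
rewrite -y0p -/L; set Y := y0 `^ _ in hCl hCg *.
have Y0 : 0 <= Y by exact: powR_ge0.
split.
  apply: le_trans lo.
  have cT0 : (0 <= (c * T)%:E)%E by rewrite lee_fin mulr_ge0 ?ltW.
  apply: le_trans (lee_wpmul2l cT0 hCg).
  rewrite -EFinM lee_fin -!mulrA
    [leRHS](_ : _ = (c * Cg) * (T * (Y * expR (- (cg * L))))); last by ring.
  by rewrite ler_wpM2r// !mulr_ge0 ?expR_ge0 ?(ltW T0).
have CT0 : (0 <= (C * T)%:E)%E by rewrite lee_fin mulr_ge0 ?ltW.
apply: (le_trans up); apply: (le_trans (lee_wpmul2l CT0 hCl)).
rewrite -EFinM lee_fin -!mulrA
  [leLHS](_ : _ = (C * Cl) * (T * (Y * expR (- (cl * L))))); last by ring.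
by rewrite ler_wpM2r// !mulr_ge0 ?expR_ge0 ?(ltW T0).
Qed.
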